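(* The proof system $\mathsf{QCDCL}^{\text{ASS-ORD}}_{\text{NO-RED}}$ p-simulates Q-resolution. That is, each Q-resolution refutation $\pi$ of a QCNF in $n$ variables can be transformed into a $\mathsf{QCDCL}^{\text{ASS-ORD}}_{\text{NO-RED}}$ refutation of size $\mathcal{O}(n^3\cdot |\pi|)$ that uses an arbitrary asserting learning scheme $\xi$. In particular, Q-resolution, $\mathsf{QCDCL}^{\text{ANY-ORD}}_{\text{NO-RED}}$ and $\mathsf{QCDCL}^{\text{ASS-ORD}}_{\text{NO-RED}}$ are p-equivalent proof systems.
   Context: QCDCL proof systems $\mathsf{QCDCL}^P_R$ are refutational proof systems for false QCNFs whose proofs are sequences of trails (sequences of decision and propagated literals, ending in a conflict $\bot$), each followed by learning a clause via (long-distance) Q-resolution along the trail, then backtracking; trails must be natural (no unit propagation or conflict may be skipped). The decision policy $P$ and unit-propagation policy $R$ are: - ANY-ORD: any remaining literal may be decided next. - ASS-ORD: a literal $d_k$ may be decided if it is existential, or if it is universal and $\text{lv}(d_1)\le\dots\le\text{lv}(d_k)$ for the decisions $d_1,\dots,d_k$ so far ($\text{lv}$ = quantifier level in the prefix). - NO-RED: a literal $p$ may be propagated only if some clause $C$ of the current formula satisfies $C|_{\text{current trail}}=(p)$ (no universal reduction during propagation). A learning scheme maps each conflicting trail to one of its learnable clauses; it is asserting if it always returns an asserting clause (one that becomes unit after backtracking to an earlier decision level) or the empty clause whenever such exists. The size of a QCDCL proof is the sum of the lengths of its trails. A proof system p-simulates another if proofs of the latter can be translated in polynomial time into proofs of the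 former of the same formula. *)

(* Defs.v *)
From mathcomp Require Import all_boot.

Set Implicit Arguments.
Unset Strict Implicit.
Unset Printing Implicit Defensive.

(** * Quantified CNFs *)

(** A literal over the variables 'I_n is a pair (x, b); b = true is the
    positive literal. Clauses are sets of literals, [set0] is the empty clause. *)
Notation lit n := ('I_n * bool)%type.
Notation clause n := {set 'I_n * bool}.

Definition neg n (l : lit n) : lit n := (l.1, ~~ l.2).

(** The prefix lists its blocks from the outermost to the innermost one;
    (true, V) is an existential block, (false, V) a universal one. *)
Notation block n := (bool * {set 'I_n})%type.

Record qcnf (n : nat) := QCNF {
  blocks : seq (block n);
  matrix : seq (clause n) }.

Definition wf_qcnf n (F : qcnf n) : bool :=
  [&& all (fun B : block n => B.2 != set0) (blocks F),
      pairwise (fun B B' : block n => [disjoint B.2 & B'.2]) (blocks F),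
      sorted (fun B B' : block n => B.1 != B'.1) (blocks F)
    & [forall x : 'I_n, has (fun B : block n => x \in B.2) (blocks F)]].

Section Formula.
Variables (n : nat) (F : qcnf n).

Definition lv (l : lit n) : nat := (find (fun B : block n => l.1 \in B.2) (blocks F)).+1.

Definition existential (l : lit n) : bool :=
  has (fun B : block n => B.1 && (l.1 \in B.2)) (blocks F).

Definition reducible (C : clause n) (u : lit n) : bool :=
  ~~ existential u && [forall e in C, existential e ==> (lv e <= lv u)].

Definition red (C : clause n) : clause n := [set l in C | ~~ reducible C l].

Definition tautological (C : clause n) : bool := [exists l in C, neg l \in C].

Definition resolvent (C D : clause n) (l : lit n) : clause n :=
  (C :\ l) :|: (D :\ neg l).

(** * Q-resolution *)

(** A reduction step may delete any set of reducible universal literals; this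
    covers both the deletion of a single one and the passage from D to [red D]. *)
Definition qres_line (prev : seq (clause n)) (C : clause n) : Prop :=
  ~~ tautological C /\
  [\/ C \in matrix F,
      exists D E l, [/\ D \in prev, E \in prev, existential l, l \in D
                      & neg l \in E /\ C = resolvent D E l]
    | exists D, [/\ D \in prev, red D \subset C & C \subset D]].

Definition qres_refutation (pi : seq (clause n)) : Prop :=
  (forall s C s', pi = s ++ C :: s' -> qres_line s C) /\
  (exists s, pi = rcons s set0).

End Formula.

(** * Trails *)

Inductive entry (n : nat) :=
  | Decide of lit n
  | Propagate of lit n & clause n.  (* literal and its antecedent clause *)

(** A trail that has run into a conflict: the literals in order, followed by
    the empty literal, whose antecedent is [conflict]. *)
Record trail (n : nat) := Trail {
  entries : seq (entry n);
  conflict : clause n }.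

Definition trail_length n (T : trail n) : nat := (size (entries T)).+1.

Definition entry_lit n (e : entry n) : lit n :=
  match e with Decide l => l | Propagate l _ => l end.

Definition assignment n (s : seq (entry n)) : seq (lit n) := map (@entry_lit n) s.

Definition decisions n (s : seq (entry n)) : seq (lit n) :=
  pmap (fun e => if e is Decide l then Some l else None) s.

(** [None] stands for a satisfied clause. *)
Definition restrict n (C : clause n) (sigma : seq (lit n)) : option (clause n) :=
  if [exists l in C, l \in sigma] then None
  else Some [set l in C | neg l \notin sigma].

Inductive decision_policy := ANY_ORD | ASS_ORD.

Section Trails.
Variables (n : nat) (P : decision_policy) (F : qcnf n).

Definition may_decide (ds : seq (lit n)) (d : lit n) : bool :=
  match P with
  | ANY_ORD => true
  | ASS_ORD => existential F d || sorted leq (map (lv F) (rcons ds d))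
  end.

(** Policy NO-RED: C becomes the unit clause (p) without universal reduction.
    Only existential literals are propagated, since learning resolves on the
    propagated literals and Q-resolution pivots are existential. *)
Definition unit_under (sigma : seq (lit n)) (C : clause n) (p : lit n) : bool :=
  existential F p && (restrict C sigma == Some [set p]).

Definition falsified (sigma : seq (lit n)) (C : clause n) : bool :=
  restrict C sigma == Some set0.

Definition entry_ok (s : seq (entry n)) (e : entry n) : Prop :=
  match e with
  | Decide d => [/\ d \notin assignment s, neg d \notin assignment s
                  & may_decide (decisions s) d]
  | Propagate p C => C \in matrix F /\ unit_under (assignment s) C p
  end.

Definition natural_at (s : seq (entry n)) (e : entry n) : Prop :=
  (forall C, C \in matrix F -> ~~ falsified (assignment s) C) /\
  (if e is Decide _ then
     forall C p, C \in matrix F -> ~~ unit_under (assignment s) C p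
   else True).

Definition conflict_trail (T : trail n) : Prop :=
  [/\ forall s e s', entries T = s ++ e :: s' -> entry_ok s e /\ natural_at s e,
      conflict T \in matrix F
    & falsified (assignment (entries T)) (conflict T)].

(** * Clause learning *)

Definition learn_step (C : clause n) (e : entry n) : clause n :=
  match e with
  | Decide _ => C
  | Propagate p D =>
      if neg p \in C then red F (resolvent (red F D) C p) else C
  end.

Definition learnable (T : trail n) : seq (clause n) :=
  let C := red F (conflict T) in C :: scanl learn_step C (rev (entries T)).

(** Cutting the trail right before one of its decisions is backtracking to an
    earlier decision level. *)
Definition asserting_clause (T : trail n) (C : clause n) : Prop :=
  exists s d s' p,
    entries T = s ++ Decide d :: s' /\ unit_under (assignment s) C p.

End Trails.

Definition scheme := forall n, qcnf n -> trail n -> clause n.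

Definition learning_scheme (P : decision_policy) (xi : scheme) : Prop :=
  forall n (F : qcnf n) T, wf_qcnf F -> conflict_trail P F T ->
    xi n F T \in learnable F T.

Definition asserting_scheme (P : decision_policy) (xi : scheme) : Prop :=
  learning_scheme P xi /\
  forall n (F : qcnf n) T, wf_qcnf F -> conflict_trail P F T ->
    (exists C, C \in learnable F T /\ (asserting_clause F T C \/ C = set0)) ->
    asserting_clause F T (xi n F T) \/ xi n F T = set0.

(** * QCDCL with unit-propagation policy NO-RED *)

(** [backtrack] is the number of entries kept after learning; 0 is a restart. *)
Record round (n : nat) := Round {
  round_trail : trail n;
  learned : clause n;
  backtrack : nat }.

Definition learn n (F : qcnf n) (C : clause n) : qcnf n :=
  QCNF (blocks F) (rcons (matrix F) C).

Definition backtracks n (R : round n) (rest : seq (round n)) : Prop :=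
  backtrack R <= size (entries (round_trail R)) /\
  (if rest is R' :: _ then
     take (backtrack R) (entries (round_trail R')) =
     take (backtrack R) (entries (round_trail R))
   else True).

Fixpoint qcdcl_derivation (P : decision_policy) n (F : qcnf n)
    (iota : seq (round n)) : Prop :=
  if iota is R :: rest then
    [/\ conflict_trail P F (round_trail R),
        learned R \in learnable F (round_trail R),
        backtracks R rest
      & qcdcl_derivation P (learn F (learned R)) rest]
  else True.

Definition qcdcl_refutation (P : decision_policy) n (F : qcnf n)
    (iota : seq (round n)) : Prop :=
  qcdcl_derivation P F iota /\
  (exists s R, iota = rcons s R /\ learned R = set0).

Fixpoint uses_scheme (xi : scheme) n (F : qcnf n) (iota : seq (round n)) : Prop :=
  if iota is R :: rest then
    learned R = xi n F (round_trail R) /\ uses_scheme xi (learn F (learned R)) rest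
  else True.

Definition qcdcl_size n (iota : seq (round n)) : nat :=
  \sum_(R <- iota) trail_length (round_trail R).

(** * Polynomial time *)

(** The machine model is a one-variable WHILE language over binary trees
    ([Leaf] is false, every [Node] is true). A primitive instruction is charged
    the size of the data it reads, so the cost of a run is polynomially related
    to the time of a Turing machine working on the serialized trees. *)
Inductive tree := Leaf | Node of tree & tree.

Fixpoint tree_size (t : tree) : nat :=
  if t is Node a b then (tree_size a + tree_size b).+1 else 1.

Fixpoint tree_eq (s t : tree) : bool :=
  match s, t with
  | Leaf, Leaf => true
  | Node a b, Node c d => tree_eq a c && tree_eq b d
  | _, _ => false
  end.

Definition tree_of_bool (b : bool) : tree := if b then Node Leaf Leaf else Leaf.

Inductive prog :=
  | Id | Nil | Head | Tail | Eq
  | Pair of prog & prog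
  | Seq of prog & prog
  | If of prog & prog & prog
  | While of prog & prog.

(** [run p x y t]: on input x, p halts with output y at cost t. *)
Inductive run : prog -> tree -> tree -> nat -> Prop :=
  | run_id x : run Id x x (tree_size x)
  | run_nil x : run Nil x Leaf (tree_size x)
  | run_head x : run Head x (if x is Node a _ then a else Leaf) (tree_size x)
  | run_tail x : run Tail x (if x is Node _ b then b else Leaf) (tree_size x)
  | run_eq x : run Eq x (if x is Node a b then tree_of_bool (tree_eq a b) else Leaf)
                   (tree_size x)
  | run_pair p q x y z s t : run p x y s -> run q x z t ->
      run (Pair p q) x (Node y z) (s + t).+1
  | run_seq p q x y z s t : run p x y s -> run q y z t ->
      run (Seq p q) x z (s + t).+1
  | run_if_true b p q x u v y s t : run b x (Node u v) s -> run p x y t ->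
      run (If b p q) x y (s + t).+1
  | run_if_false b p q x y s t : run b x Leaf s -> run q x y t ->
      run (If b p q) x y (s + t).+1
  | run_while_stop b p x s : run b x Leaf s -> run (While b p) x x s.+1
  | run_while_step b p x u v y z r s t : run b x (Node u v) r -> run p x y s ->
      run (While b p) y z t -> run (While b p) x z (r + s + t).+1.

(** Variables are coded in unary; this is harmless, since the code of a formula
    lists its n variables. *)
Definition tree_of_nat (k : nat) : tree := iter k (Node Leaf) Leaf.

Definition tree_of_seq T (f : T -> tree) (s : seq T) : tree :=
  foldr (fun x t => Node (f x) t) Leaf s.

Definition tree_of_lit n (l : lit n) : tree :=
  Node (tree_of_nat l.1) (tree_of_bool l.2).

Definition tree_of_clause n (C : clause n) : tree :=
  tree_of_seq (@tree_of_lit n) (enum C).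

Definition tree_of_block n (B : block n) : tree :=
  Node (tree_of_bool B.1)
       (tree_of_seq (fun x : 'I_n => tree_of_nat x) (enum B.2)).

Definition tree_of_qcnf n (F : qcnf n) : tree :=
  Node (tree_of_nat n)
    (Node (tree_of_seq (@tree_of_block n) (blocks F))
          (tree_of_seq (@tree_of_clause n) (matrix F))).

Definition tree_of_entry n (e : entry n) : tree :=
  match e with
  | Decide l => Node Leaf (tree_of_lit l)
  | Propagate l C => Node (Node Leaf Leaf) (Node (tree_of_lit l) (tree_of_clause C))
  end.

Definition tree_of_round n (R : round n) : tree :=
  Node (Node (tree_of_seq (@tree_of_entry n) (entries (round_trail R)))
             (tree_of_clause (conflict (round_trail R))))
       (Node (tree_of_clause (learned R)) (tree_of_nat (backtrack R))).

(** * Proof systems and simulations *)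

Record proof_system := ProofSystem {
  proof : nat -> Type;
  refutes : forall n, qcnf n -> proof n -> Prop;
  tree_of_proof : forall n, proof n -> tree }.

Definition Qres : proof_system :=
  ProofSystem qres_refutation (fun n => tree_of_seq (@tree_of_clause n)).

Definition QCDCL_NO_RED (P : decision_policy) : proof_system :=
  ProofSystem (@qcdcl_refutation P) (fun n => tree_of_seq (@tree_of_round n)).

(** [p_simulates S S']: some program translates, in polynomial time, every
    S'-refutation of a QCNF into an S-refutation of the same QCNF. *)
Definition p_simulates (S S' : proof_system) : Prop :=
  exists (p : prog) (k : nat), forall n (F : qcnf n) (pi : proof S' n),
    wf_qcnf F -> refutes F pi ->
    exists (rho : proof S n) (t : nat),
      let input := Node (tree_of_qcnf F) (tree_of_proof pi) in
      [/\ refutes F rho,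
          run p input (tree_of_proof rho) t
        & t <= k * tree_size input ^ k].

Definition p_equivalent (S S' : proof_system) : Prop :=
  p_simulates S S' /\ p_simulates S' S.

(* Main.v *)
Require Import Defs.
From mathcomp Require Import all_boot zify.

Set Implicit Arguments.
Unset Strict Implicit.
Unset Printing Implicit Defensive.

(** A set of literals is closed if it is consistent, falsifies no clause and is stable under
    unit propagation of existential literals. A clause [C] is absorbed if no closed set
    contains the negations of all its literals, and every closed set containing those of all
    literals but an existential one contains that one. Axioms are absorbed, and if [D] and
    [E] are absorbed then no closed set falsifies a resolvent of them; absorbing [C] is then a
    matter of the following task: if no closed set contains [A] and [d], learn clauses until
    every closed set containing [A] contains [neg d]. Decide [A] by increasing levels, then
    [d]. The resulting conflict yields an asserting clause, which is falsified by the
    propagation closure of [A] or extends it by a new literal, so at most n conflicts are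
    needed. The same task, with [d] a universal literal of highest level, removes the
    reducible literals of a clause one by one. A clause costs O(n) tasks of at most n trails
    of length O(n). The empty clause being absorbed means that propagation alone leads to a
    conflict.

    Conversely, without reductions during propagation every clause that occurs while learning is
    falsified by the trail, hence not a tautology, so learning is plain Q-resolution.

    Both translations are polynomial time, as their loops add data of polynomially bounded size to
    their states: a clause in n variables has size O(n^2). *)

(** * Literals and trails *)

(** An arbitrary scheme leaves the shape of the learned clauses unknown, so the lines of a
    Q-resolution refutation are not reproduced; only their effect on propagation is. Stating that
    effect through all closed sets makes it monotone: a learned clause can only remove closed sets,
    so nothing achieved is ever lost. The obstacle is universal reduction. Propagation ignores it,
    so absorbing C does not by itself make the falsification of [red F C] contradictory. The way out
    is that universal literals are never propagated: a set A that forces a universal literal outside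
    A is already contradictory. The level order does not hinder the tasks, since only their last
    decision may leave the sorted order, and then it is existential. It even helps: it is the reason
    why every conflict offers an asserting clause or the empty one. A scheme is any function and
    need not be computable. The polynomial-time translations therefore fix one particular asserting
    scheme, the last learnable clause. *)

Lemma has_last_split (T : Type) (a : pred T) s : has a s ->
  exists s1 x s2, [/\ s = s1 ++ x :: s2, a x & ~~ has a s2].
Proof.
elim: s => //= x s IH; case: (boolP (has a s)) => [/IH[s1 [y [s2 [-> ay n2]]]]|ns].
  by exists (x :: s1), y, s2.
by rewrite orbF => ax; exists [::], x, s.
Qed.

Section Literals.
Variables (n : nat) (F : qcnf n).
Implicit Types (l p : lit n) (C D : clause n) (sigma : seq (lit n)).

Lemma negK : involutive (@neg n).
Proof. by case=> x b; rewrite /neg /= negbK. Qed.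

Lemma neg_eq l : (neg l == l) = false.
Proof. by apply/eqP; case: l => x [] []. Qed.

Lemma eq_neg l k : (neg l == k) = (l == neg k).
Proof. by rewrite -(inj_eq (can_inj negK)) negK. Qed.

Lemma existential_neg l : existential F (neg l) = existential F l.
Proof. by []. Qed.

Lemma lv_neg l : lv F (neg l) = lv F l.
Proof. by []. Qed.

Lemma eq_var l k : l.1 = k.1 -> l = k \/ l = neg k.
Proof.
by case: l k => x [] [y []] /= ->; rewrite /neg /=; [left|right|right|left].
Qed.

(** The second conjunct accounts for [restrict] returning [None] on satisfied clauses. The form as a
    test over [enum C] is the one evaluated by the machine model later. *)
Lemma falsifiedE sigma C :
  falsified sigma C = all (fun l => (neg l \in sigma) && (l \notin sigma)) (enum C).
Proof.
rewrite /falsified /restrict; case: existsP => [[l /andP[lC ls]]|nex].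
  apply/esym/allPn; exists l; first by rewrite mem_enum.
  by rewrite ls andbF.
apply/eqP/allP => [[/setP e] l|H].
  rewrite mem_enum => lC; have := e l; rewrite !inE lC /= => /negbFE ->.
  by apply/negP => ls; case: nex; exists l; rewrite lC.
congr Some; apply/setP => l; rewrite !inE; case lC: (l \in C) => //=.
by have /andP[-> _] := H l (eq_ind_r is_true lC (mem_enum _ _)).
Qed.

Lemma falsifiedP sigma C :
  reflect (forall l, l \in C -> neg l \in sigma /\ l \notin sigma) (falsified sigma C).
Proof.
rewrite falsifiedE; apply: (iffP allP) => H l.
  by move=> lC; apply/andP/H; rewrite mem_enum.
by rewrite mem_enum => /H/andP.
Qed.

Lemma unit_underE sigma C p :
  unit_under F sigma C p =
  [&& existential F p, p \in C, neg p \notin sigma &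
      all (fun l => (l \notin sigma) && ((l == p) || (neg l \in sigma))) (enum C)].
Proof.
rewrite /unit_under; case: (existential F p) => //=.
rewrite /restrict; case: existsP => [[l /andP[lC ls]]|nex].
  apply/esym/and3P => -[_ _ /allP/(_ l)]; rewrite mem_enum => /(_ lC).
  by rewrite ls.
apply/eqP/and3P => [[/setP e]|[pC np /allP H]].
  have := e p; rewrite !inE eqxx => /andP[pC np]; split=> //.
  apply/allP => l; rewrite mem_enum => lC; apply/andP; split.
    by apply/negP => ls; case: nex; exists l; rewrite lC.
  by have := e l; rewrite !inE lC /= => <-; case: (_ \in _).
congr Some; apply/setP => l; rewrite !inE; case: eqP => [->|lp]; first by rewrite pC np.
apply/negbTE; rewrite negb_and negbK orbC; case lC: (l \in C); last by rewrite orbT.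
have := H l; rewrite mem_enum => /(_ lC)/andP[_].
by case: eqP => // _ /= ->.
Qed.

Lemma unit_underP sigma C p :
  reflect [/\ existential F p, p \in C, neg p \notin sigma &
           forall l, l \in C -> l \notin sigma /\ (l = p \/ neg l \in sigma)]
          (unit_under F sigma C p).
Proof.
rewrite unit_underE; apply: (iffP and4P) => -[ep pC np H]; split=> //.
  move=> l lC; have /andP[] := allP H l (eq_ind_r is_true lC (mem_enum _ _)).
  by move=> -> /orP[/eqP|]; split=> //; [left|right].
apply/allP => l; rewrite mem_enum => /H[-> [->|->]]; rewrite ?eqxx ?orbT //.
Qed.

(** Whether a literal is reducible depends on the existential literals of the clause only, and
    reduction deletes none of them. *)
Lemma reducible_red C l : reducible F (red F C) l = reducible F C l.
Proof.
rewrite /reducible; case: (boolP (existential F l)) => //= _.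
apply: eq_forallb => e; rewrite inE; case: (e \in C) => //=.
by rewrite /reducible; case: (existential F e) => //=; rewrite implybT.
Qed.

Lemma red_id C : red F (red F C) = red F C.
Proof.
apply/setP => l; rewrite in_set reducible_red andbC.
by rewrite [in RHS]in_set [in LHS]in_set; case: (l \in C); case: (reducible F C l).
Qed.

Lemma red_subset C : red F C \subset C.
Proof. by apply/subsetP => l; rewrite inE => /andP[]. Qed.

Lemma in_red_existential C l : existential F l -> (l \in red F C) = (l \in C).
Proof. by move=> el; rewrite inE /reducible el andbT. Qed.

End Literals.

(** * Consistency of trails and the invariant of clause learning *)

Section TrailTheory.
Variables (n : nat) (P : decision_policy) (F : qcnf n).
Implicit Types (s t es : seq (entry n)) (e : entry n) (C : clause n) (M : {set lit n}).

Definition trail_ok es : Prop :=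
  forall s e s', es = s ++ e :: s' -> entry_ok P F s e /\ natural_at F s e.

Lemma trail_ok_nil : trail_ok [::].
Proof. by case. Qed.

Lemma trail_ok_prefix s t : trail_ok (s ++ t) -> trail_ok s.
Proof. by move=> H s1 e s2 E; apply: (H _ _ (s2 ++ t)); rewrite E -catA. Qed.

Lemma trail_ok_rcons s e :
  trail_ok s -> entry_ok P F s e -> natural_at F s e -> trail_ok (rcons s e).
Proof.
move=> ok eok nat s1 e1 s2; case/lastP: s2 => [|s2 e2].
  by rewrite cats1 => /rcons_inj[<- <-].
by rewrite -rcons_cons -rcons_cat => /rcons_inj[E _]; apply: ok E.
Qed.

Lemma trail_ok_last s e : trail_ok (rcons s e) ->
  [/\ trail_ok s, entry_ok P F s e & natural_at F s e].
Proof.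
move=> ok; have [] := ok s e [::]; first by rewrite cats1.
by split=> //; apply: (@trail_ok_prefix _ [:: e]); rewrite cats1.
Qed.

Lemma assignment_rcons s e : assignment (rcons s e) = rcons (assignment s) (entry_lit e).
Proof. by rewrite /assignment map_rcons. Qed.

Lemma decisions_cat s t : decisions (s ++ t) = decisions s ++ decisions t.
Proof. by rewrite /decisions pmap_cat. Qed.

Lemma decisions_sub s : {subset decisions s <= assignment s}.
Proof.
elim: s => //= -[d|p D] s IH l; rewrite ?inE //.
  by case/orP => [->//|/IH ->]; rewrite orbT.
by move=> /IH ->; rewrite orbT.
Qed.

Lemma mem_decisions d s : d \in decisions s -> exists s1 s2, s = s1 ++ Decide d :: s2.
Proof.
elim: s => //= -[d'|p D] s IH; last first.
  by move/IH => [s1 [s2 ->]]; exists (Propagate p D :: s1), s2.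
rewrite inE => /orP[/eqP->|/IH[s1 [s2 ->]]]; first by exists [::], s.
by exists (Decide d' :: s1), s2.
Qed.

Lemma entry_ok_fresh s e : entry_ok P F s e ->
  entry_lit e \notin assignment s /\ neg (entry_lit e) \notin assignment s.
Proof.
case: e => [d []//|p D /= [_ /unit_underP[_ pD np]]] /(_ _ pD)[].
by split.
Qed.

(** Every entry is fresh up to sign when it is added. Both the consistency of trails and the bound n
    on their length follow. *)
Lemma trail_vars_uniq s : trail_ok s -> uniq [seq l.1 | l <- assignment s].
Proof.
elim/last_ind: s => // s e IH /trail_ok_last[/IH us /entry_ok_fresh[f1 f2] _].
rewrite assignment_rcons map_rcons rcons_uniq us andbT.
apply/mapP => -[l ls /esym/eq_var[E|E]]; first by rewrite -E ls in f1.
by rewrite -E ls in f2.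
Qed.

Lemma trail_consistent s l : trail_ok s -> l \in assignment s -> neg l \notin assignment s.
Proof.
move=> /trail_vars_uniq; elim: (assignment s) => // k t IH /= /andP[kt /IH{}IH].
rewrite !inE => /orP[/eqP->|lt].
  rewrite neg_eq /=; apply/negP => H; case/negP: kt.
  by apply/mapP; exists (neg k).
rewrite negb_or IH // andbT; apply/eqP => E; case/negP: kt.
by apply/mapP; exists l; rewrite // -E.
Qed.

Lemma trail_size s : trail_ok s -> size s <= n.
Proof.
move=> /trail_vars_uniq us; rewrite -[size s](size_map (@entry_lit n)).
rewrite -(size_map fst) -(card_uniqP us) -[X in _ <= X]card_ord.
exact: max_card.
Qed.

Lemma trail_split s e t : trail_ok (s ++ e :: t) ->
  entry_lit e \notin assignment s /\ neg (entry_lit e) \notin assignment s.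
Proof. by case/(_ _ _ _ erefl) => /entry_ok_fresh. Qed.

(** The part s is still to be walked through backwards and t has been passed. Resolving on a
    propagated literal replaces its negation by literals falsified before it, so of the passed
    entries only decisions still falsify literals of the clause. Hence all learnable clauses are
    falsified by the trail, and the last one by its decisions alone. *)
Lemma learn_steps s t C : trail_ok (s ++ t) ->
  (forall l, l \in C -> neg l \in assignment s ++ decisions t) ->
  (forall D l, D \in C :: scanl (learn_step F) C (rev s) -> l \in D ->
     neg l \in assignment s ++ decisions t) /\
  (forall l, l \in foldl (learn_step F) C (rev s) -> neg l \in decisions (s ++ t)).
Proof.
elim/last_ind: s t C => [|s e IH] t C ok HC /=.
  by split => // D l; rewrite inE => /eqP ->; apply: HC.
rewrite rev_rcons /= cat_rcons; rewrite cat_rcons in ok.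
have incl l : neg l \in assignment s ++ decisions (e :: t) ->
    neg l \in assignment (rcons s e) ++ decisions t.
  rewrite assignment_rcons !mem_cat mem_rcons inE.
  case: e {ok HC} => [d|p D] /=; last by case/orP => ->; rewrite ?orbT.
  by rewrite inE => /or3P[|/eqP|] ->; rewrite ?eqxx ?orbT.
have [|H1 H2] := IH (e :: t) (learn_step F C e) ok.
  move=> l; have HC' k : k \in C -> neg k != entry_lit e ->
      neg k \in assignment s ++ decisions t.
    move=> /HC; rewrite assignment_rcons !mem_cat mem_rcons inE -orbA.
    by case/or3P => [/eqP->|->|->]; rewrite ?eqxx ?orbT.
  have [eok _] := ok s e t erefl.
  case: e {IH ok incl HC} HC' eok => [d|p D] /= HC' eok.
    move=> lC; rewrite mem_cat inE; have := HC' l lC; rewrite mem_cat.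
    by case: eqP => [_|_ /(_ isT)/orP[]->]; rewrite ?orbT.
  case: ifP => [npC|npC lC]; last first.
    by apply: HC' => //; apply/eqP => E; rewrite -E negK lC in npC.
  rewrite inE => /andP[+ _]; rewrite !inE => /orP[/and3P[lp lD _]|/andP[lp lC]].
    have [_ /unit_underP[_ _ _ /(_ l lD)[_ [E|]]]] := eok; first by rewrite E eqxx in lp.
    by rewrite mem_cat => ->.
  by apply: HC' => //; rewrite eq_neg.
split=> // D l; rewrite inE => /orP[/eqP->|DI lD]; first exact: HC.
by apply: incl; apply: H1 DI lD.
Qed.

Lemma learnable_falsified T C l : conflict_trail P F T ->
  C \in learnable F T -> l \in C -> neg l \in assignment (entries T).
Proof.
case: T => es K [ok _ /falsifiedP fK] /= CI lC.
have [||H _] := @learn_steps es [::] (red F K); first by rewrite cats0.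
  by move=> k; rewrite inE cats0 => /andP[/fK[]].
by have := H _ _ CI lC; rewrite cats0.
Qed.

Lemma last_learnable T :
  last set0 (learnable F T) = foldl (learn_step F) (red F (conflict T)) (rev (entries T)).
Proof.
by rewrite /learnable /=; elim: (rev _) (red _ _) => //= e s IH C.
Qed.

Lemma last_learnable_in T : last set0 (learnable F T) \in learnable F T.
Proof. by rewrite /learnable /= mem_last. Qed.

Lemma foldl_learn_red C s : red F C = C ->
  red F (foldl (learn_step F) C s) = foldl (learn_step F) C s.
Proof.
elim: s C => //= -[d|p D] s IH C rC; apply: IH => //=.
by case: ifP => // _; rewrite red_id.
Qed.

End TrailTheory.

(* Only decisions falsify literals of the last learnable clause. As the clause is reduced,
   a universal literal of it lies below an existential one, which the level order does not
   allow to be decided first; so the last of these decisions is existential, and the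
   clause is unit right before it. *)
Lemma last_learnable_asserting n (F : qcnf n) T : conflict_trail ASS_ORD F T ->
  asserting_clause F T (last set0 (learnable F T)) \/ last set0 (learnable F T) = set0.
Proof.
move=> cT; have [ok KF fK] := cT; have fG l := @learnable_falsified _ _ _ _ _ l cT (last_learnable_in F T).
set G := last _ _ in fG *.
have rG : red F G = G by rewrite /G last_learnable foldl_learn_red // red_id.
have dG l : l \in G -> neg l \in decisions (entries T).
  rewrite /G last_learnable.
  have [|k|_ H] := @learn_steps n ASS_ORD F (entries T) [::] (red F (conflict T)).
  - by rewrite cats0.
  - by rewrite inE cats0 => /andP[/(falsifiedP _ _ fK)[]].
  by move/H; rewrite cats0.
case: (set_0Vmem G) => [->|[l lG]]; first by right.
left; pose a e := if e is Decide d then neg d \in G else false.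
have /has_last_split[s [e [s' [E ae nh]]]] : has a (entries T).
  have /mem_decisions[s1 [s2 ->]] := dG _ lG.
  by rewrite has_cat /= negK lG /= orbT.
case: e E ae => // d E /= dGd.
have before k : k \in G -> k != neg d -> neg k \in decisions s.
  move=> kG kd; have := dG k kG; rewrite E decisions_cat mem_cat /= inE eq_neg (negbTE kd) /=.
  case/orP => // /mem_decisions[s1 [s2 Es]]; case/negP: nh.
  by rewrite Es has_cat /= negK kG orbT.
rewrite E in ok fG; have [dok dn] := trail_split ok.
have [[_ _ /= H] _] := ok s (Decide d) s' erefl.
exists s, d, s', (neg d); split=> //; apply/unit_underP.
split=> //; last first.
- move=> k kG; split; last first.
    by case: (eqVneq k (neg d)) => [|kd]; [left|right; apply/decisions_sub/before].
  apply/negP => ks; have := trail_consistent ok (_ : k \in _).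
  rewrite /assignment map_cat mem_cat ks => /(_ isT)/negP; apply.
  by have := fG k kG; rewrite /assignment map_cat.
- by rewrite negK.
rewrite existential_neg; case: (boolP (existential F d)) H => //= ud sd.
move: dGd; rewrite -rG inE => /andP[nG]; rewrite /reducible existential_neg ud /=.
case/forallPn => e; rewrite !negb_imply -ltnNge => /and3P[eG ee le].
have ed : e != neg d by apply: contraNneq ud => E'; rewrite E' in ee.
move: sd; rewrite map_rcons (sorted_pairwise leq_trans) pairwise_rcons => /andP[/allP sd _].
by have := sd _ (map_f (lv F) (before e eG ed)); rewrite leqNgt lv_neg le.
Qed.

(** * Unit propagation *)

Section Propagation.
Variables (n : nat) (F : qcnf n).
Implicit Types (M : {set lit n}) (A : seq (lit n)) (C D : clause n).

(** Unlike in [falsified] and [unit_under], satisfied clauses are not set aside; consistency makes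
    up for this, as a literal whose negation is in M is not in M. *)
Definition up_closed M : Prop :=
  [/\ forall l, l \in M -> neg l \notin M,
      forall C, C \in matrix F -> ~ (forall l, l \in C -> neg l \in M)
    & forall C p, C \in matrix F -> p \in C -> existential F p ->
        (forall l, l \in C -> l != p -> neg l \in M) -> p \in M].

(** Quantifying over all closed sets, instead of running propagation from A, makes this and
    [implied] monotone in A and stable under adding clauses. *)
Definition refuted A : Prop := forall M, up_closed M -> {subset A <= M} -> False.

Definition implied A l : Prop := forall M, up_closed M -> {subset A <= M} -> l \in M.

Definition negs C : seq (lit n) := [seq neg l | l <- enum C].

Definition negs_but C l : seq (lit n) := [seq neg k | k <- enum C & k != l].

(* The first component follows from the second one unless [C] is purely universal. *)
Definition absorbed C : Prop :=
  refuted (negs C) /\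
  forall l, l \in C -> existential F l -> implied (negs_but C l) l.

Lemma refuted_sub A B : {subset A <= B} -> refuted A -> refuted B.
Proof. by move=> AB rA M cM BM; apply: (rA M cM) => l /AB/BM. Qed.

Lemma mem_negs C l : (l \in negs C) = (neg l \in C).
Proof. by rewrite -[l in LHS]negK mem_map ?mem_enum //; apply: can_inj (@negK n). Qed.

Lemma mem_negs_but C k l : (l \in negs_but C k) = (neg l \in C) && (neg l != k).
Proof.
rewrite -[l in LHS]negK mem_map; last exact: can_inj (@negK n).
by rewrite mem_filter mem_enum andbC.
Qed.

(** A consistent set has at most one literal per variable, and here the variable of d is missing.
    This is what stops the count of new literals in [simulate_task]. *)
Lemma up_closed_card_lt M d : up_closed M -> d \notin M -> neg d \notin M -> #|M| < n.
Proof.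
move=> cM dM nM; have n0 : 0 < n by apply: leq_ltn_trans (ltn_ord d.1).
have inj : {in M &, injective fst}.
  case: cM => cons _ _ l k lM kM /eq_var[//|E]; have := cons k kM.
  by rewrite -E lM.
rewrite -(card_in_imset inj) -[X in _ < X](card_ord n) -[#|'I_n|]cardsT.
apply: proper_card; rewrite properE subsetT /=; apply/subsetPn; exists d.1 => //.
apply/imsetP => -[l lM /esym/eq_var[E|E]]; first by rewrite E in lM; rewrite lM in dM.
by rewrite E in lM; rewrite lM in nM.
Qed.

Lemma up_closed_trail P es : trail_ok P F es ->
  (forall C, C \in matrix F -> ~~ falsified (assignment es) C) ->
  (forall C p, C \in matrix F -> ~~ unit_under F (assignment es) C p) ->
  up_closed [set l in assignment es].
Proof.
move=> ok nf nu; have cons l : l \in assignment es -> neg l \notin assignment es.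
  exact: trail_consistent ok.
split.
- by move=> l; rewrite !inE => /cons.
- move=> C CF H; case/negP: (nf C CF); apply/falsifiedP => l /H; rewrite inE => nl.
  by split=> //; rewrite -[l]negK; apply: cons.
move=> C p CF pC ep H; rewrite inE; apply/negPn/negP => pn.
have H' l : l \in C -> l != p -> neg l \in assignment es.
  by move=> lC lp; have := H l lC lp; rewrite inE.
have npn : neg p \notin assignment es.
  apply/negP => np; case/negP: (nf C CF); apply/falsifiedP => l lC.
  have nl : neg l \in assignment es by case: (eqVneq l p) => [->//|/(H' l lC)].
  by split=> //; rewrite -[l]negK; apply: cons.
case/negP: (nu C p CF); apply/unit_underP; split=> // l lC.
case: (eqVneq l p) => [->|lp]; first by split=> //; left.
have nl := H' l lC lp.
by split; [rewrite -[l]negK; apply: cons | right].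
Qed.

(** Every propagation is forced in a closed set, so a trail stays inside each closed set that
    contains its decisions. *)
Lemma trail_sound P es M : trail_ok P F es -> up_closed M ->
  {subset decisions es <= M} -> {subset assignment es <= M}.
Proof.
move=> ok cM; elim/last_ind: es ok => // s e IH /trail_ok_last[ok eok _] dM l.
have {}IH : {subset assignment s <= M}.
  by apply: IH => // k kd; apply: dM; rewrite -cats1 decisions_cat mem_cat kd.
rewrite assignment_rcons mem_rcons inE => /orP[/eqP->{l}|/IH//].
case: e eok dM => [d _|p C [CF /unit_underP[ep pC np H]] _] /=.
  by apply; rewrite -cats1 decisions_cat mem_cat mem_head orbT.
case: cM => _ _ /(_ C p CF pC ep); apply=> l lC lp.
by apply: IH; case: (H l lC) => _ [E|//]; rewrite E eqxx in lp.
Qed.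

End Propagation.

(** * Greedy natural trails along a list of intended decisions *)

Section Attempt.
Variables (n : nat) (F : qcnf n).
Implicit Types (ds : seq (lit n)) (es : seq (entry n)) (sigma : seq (lit n)).

Definition conflicts sigma : seq (clause n) := [seq C <- matrix F | falsified sigma C].

Definition propagations sigma : seq (entry n) :=
  flatten [seq [seq Propagate p C | p <- enum C & unit_under F sigma C p] | C <- matrix F].

(** The order of the cases makes the trail natural: a conflict stops it, and a decision is made only
    when nothing can be propagated. Listed decisions whose variable is already assigned are
    dropped. *)
Definition trail_step (st : seq (lit n) * seq (entry n)) :=
  let: (ds, es) := st in
  let sigma := assignment es in
  if conflicts sigma is _ :: _ then st
  else if propagations sigma is e :: _ then (ds, rcons es e)
  else if ds is d :: ds' then
    if (d \in sigma) || (neg d \in sigma) then (ds', es) else (ds', rcons es (Decide d))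
  else st.

(** The number of iterations suffices to get stuck: each effective step consumes a listed decision
    or adds an entry to a trail of length at most n, and a decision does both. *)
Definition attempt_state ds :=
  iter (n + size ds) trail_step (ds, [::]).

Definition attempt ds : option (trail n) :=
  let es := (attempt_state ds).2 in
  if conflicts (assignment es) is C :: _ then Some (Trail es C) else None.

Lemma conflicts_nil sigma : conflicts sigma = [::] ->
  forall C, C \in matrix F -> ~~ falsified sigma C.
Proof. by move=> E C CF; apply/negP => fC; have := mem_filter (falsified sigma) C (matrix F);
  rewrite -/(conflicts _) E fC CF. Qed.

Lemma conflicts_cons sigma C s : conflicts sigma = C :: s ->
  C \in matrix F /\ falsified sigma C.
Proof.
move=> E; have := mem_filter (falsified sigma) C (matrix F).
by rewrite -/(conflicts _) E mem_head => /esym/andP[].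
Qed.

Lemma propagations_nil sigma : propagations sigma = [::] ->
  forall C p, C \in matrix F -> ~~ unit_under F sigma C p.
Proof.
rewrite /propagations; elim: (matrix F) => //= D m IH.
case ED: (map _ _) => [|//] /= /IH{}IH C p; rewrite inE => /orP[/eqP->|/IH//].
apply/negP => U; have pD : p \in [seq q <- enum D | unit_under F sigma D q].
  by rewrite mem_filter U mem_enum; case/unit_underP: U.
by move: ED pD; case: [seq q <- _ | _].
Qed.

Lemma propagations_cons sigma e s : propagations sigma = e :: s ->
  exists p C, [/\ e = Propagate p C, C \in matrix F & unit_under F sigma C p].
Proof.
rewrite /propagations; elim: (matrix F) => //= D m IH.
case E: [seq p <- enum D | unit_under F sigma D p] => [|p t] /=.
  move/IH=> [p [C [-> Cm U]]]; exists p, C; split=> //; rewrite inE Cm orbT //.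
case=> <- _; exists p, D; split=> //; first exact: mem_head.
have := mem_filter (unit_under F sigma D) p (enum D).
by rewrite E mem_head => /esym/andP[].
Qed.

(** This is asked of the list, not of the decisions really made. The latter form a subsequence of
    it, and subsequences of sorted lists are sorted. *)
Definition admissible ds := forall pre d post, ds = pre ++ d :: post ->
  existential F d || sorted leq (map (lv F) (rcons pre d)).

(** Here [pre] is the consumed part of the list. The last condition locates each decision in it:
    whatever the list puts before d has been assigned before d is decided. So if the final literal
    of a list gets decided, the trail before it covers all the others. *)
Definition attempt_inv ds0 (st : seq (lit n) * seq (entry n)) :=
  exists pre, [/\ ds0 = pre ++ st.1,
    trail_ok ASS_ORD F st.2,
    subseq (decisions st.2) pre,
    forall x, x \in pre -> (x \in assignment st.2) || (neg x \in assignment st.2)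
  & forall s d s', st.2 = s ++ Decide d :: s' -> exists pre1 pre2,
     [/\ pre = pre1 ++ d :: pre2, subseq (decisions s) pre1, subseq (decisions s') pre2
       & forall x, x \in pre1 -> (x \in assignment s) || (neg x \in assignment s)]].

Lemma attempt_inv_step ds0 st : admissible ds0 ->
  attempt_inv ds0 st -> attempt_inv ds0 (trail_step st).
Proof.
move=> adm; case: st => ds es [pre [/= E ok sub ass split]] /=.
case Ec: (conflicts _) => [|K Ks]; last by exists pre.
have nf := conflicts_nil Ec.
case Ep: (propagations _) => [|e es']; last first.
  have [p [C [-> CF U]]] := propagations_cons Ep.
  exists pre; split=> //=.
  - by apply: trail_ok_rcons.
  - by rewrite -cats1 decisions_cat cats0.
  - by move=> x /ass; rewrite assignment_rcons !mem_rcons !inE => /orP[]->; rewrite ?orbT.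
  move=> s d s'; case/lastP: s' => [|s' e']; first by rewrite cats1 => /rcons_inj[].
  rewrite -rcons_cons -rcons_cat => /rcons_inj[/split[pre1 [pre2 [-> s1 s2 H]]] <-].
  by exists pre1, pre2; split=> //; rewrite -cats1 decisions_cat cats0.
have nu := propagations_nil Ep.
case: ds E => [|d ds] E; first by exists pre.
case: ifPn => [dass|]; [|rewrite negb_or => /andP[dn ndn]].
  exists (rcons pre d); split=> //=; first by rewrite cat_rcons.
  - by apply: subseq_trans sub _; exact: subseq_rcons.
  - by move=> x; rewrite mem_rcons inE => /orP[/eqP->//|/ass].
  move=> s x s' /split[pre1 [pre2 [-> s1 s2 H]]]; exists pre1, (rcons pre2 d).
  split=> //; first by rewrite rcons_cat.
  by apply: subseq_trans s2 _; exact: subseq_rcons.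
have subr : subseq (rcons (decisions es) d) (rcons pre d).
  by rewrite -!cats1; apply: cat_subseq.
exists (rcons pre d); split=> //=; first by rewrite cat_rcons.
- apply: trail_ok_rcons => //; split=> //=.
  have /orP[->//|H] := adm _ _ _ E; apply/orP; right.
  by apply: (subseq_sorted leq_trans _ H); apply: map_subseq.
- by rewrite -cats1 decisions_cat cats1.
- move=> x; rewrite assignment_rcons !mem_rcons !inE => /orP[->//|/ass/orP[]->];
  by rewrite ?orbT.
move=> s x s'; case/lastP: s' => [|s' e'].
  by rewrite cats1 => /rcons_inj[<- <-]; exists pre, [::]; split=> //; rewrite cats1.
rewrite -rcons_cons -rcons_cat => /rcons_inj[/split[pre1 [pre2 [-> s1 s2 H]]] <-].
exists pre1, (rcons pre2 d); split=> //; first by rewrite rcons_cat.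
by rewrite -cats1 decisions_cat cats1 -!cats1; apply: cat_subseq.
Qed.

Lemma attempt_inv_iter ds k : admissible ds ->
  attempt_inv ds (iter k trail_step (ds, [::])).
Proof.
move=> adm; elim: k => [|k IH]; last by rewrite iterS; apply: attempt_inv_step.
by exists [::]; split=> //; [exact: trail_ok_nil|case].
Qed.

Lemma iter_stuck (T : Type) (f : T -> T) (mu : T -> nat) (I : T -> Prop) x :
  (forall y, I y -> I (f y)) -> (forall y, I y -> f y = y \/ mu (f y) < mu y) ->
  I x -> f (iter (mu x) f x) = iter (mu x) f x.
Proof.
move=> If dec; suff: forall m y, mu y <= m -> I y -> f (iter m f y) = iter m f y by apply.
elim=> [|m IH] y lt Iy.
  by case: (dec y Iy) => //= /leq_trans/(_ lt).
case: (dec y Iy) => [E|lt'].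
  by rewrite (_ : iter _ _ _ = y) //; elim: m.+1 => //= k ->.
by rewrite !iterSr; apply: IH (If _ Iy); rewrite -ltnS (leq_trans lt').
Qed.

Lemma attempt_state_stuck ds : admissible ds ->
  trail_step (attempt_state ds) = attempt_state ds.
Proof.
move=> adm; pose mu (st : seq (lit n) * seq (entry n)) := size st.1 + (n - size st.2).
rewrite /attempt_state (_ : n + size ds = mu (ds, [::])); last by rewrite /mu subn0 addnC.
apply: (@iter_stuck _ _ mu (attempt_inv ds)) => [st|st|].
- exact: attempt_inv_step.
- move=> /(attempt_inv_step adm); case: st => ds' es /=; rewrite /mu /=.
  case: (conflicts _) => [|K Ks]; last by left.
  case: (propagations _) => [|e es'] /=; last first.
    move=> [pre [_ ok _ _ _]]; right; rewrite ltn_add2l size_rcons.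
    by apply: ltn_sub2l => //; have := trail_size ok; rewrite /= size_rcons.
  case: ds' => [|d ds'] /=; first by left.
  case: ifP => _; first by right.
  move=> _; right; rewrite /= addSn ltnS leq_add2l size_rcons; exact: leq_sub2l.
by apply: (attempt_inv_iter 0).
Qed.

Lemma attempt_conflict ds T : admissible ds -> attempt ds = Some T ->
  conflict_trail ASS_ORD F T /\ attempt_inv ds ((attempt_state ds).1, entries T).
Proof.
move=> adm; rewrite /attempt; have := attempt_inv_iter (n + size ds) adm.
rewrite -/(attempt_state ds); case: (attempt_state ds) => ds' es /= inv.
case E: (conflicts _) => [//|C s] [<-] /=; split=> //.
by have [? ?] := conflicts_cons E; split=> //; case: inv => pre [].
Qed.

(** At a fixed point without conflict every other case would change the length of the trail or of
    the list. So nothing can be propagated and the list is used up, which makes the assignment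
    closed. *)
Lemma attempt_none ds : admissible ds -> attempt ds = None ->
  exists es, attempt_inv ds ([::], es) /\ up_closed F [set l in assignment es].
Proof.
move=> adm; rewrite /attempt; have := attempt_inv_iter (n + size ds) adm.
have := attempt_state_stuck adm; rewrite -/(attempt_state ds).
case: (attempt_state ds) => ds' es /=.
case E: (conflicts _) => [|//]; case E': (propagations _) => [|e es']; last first.
  by case=> /(congr1 size); rewrite size_rcons => /esym/n_Sn.
case: ds' => [_|d ds'] /=; last by case: ifP => _ [] /(congr1 size) /= /n_Sn.
move=> inv _; exists es; split=> //; apply: (@up_closed_trail _ _ ASS_ORD).
- by case: inv => pre [].
- exact: conflicts_nil.
exact: propagations_nil.
Qed.

End Attempt.

(** * Simulating Q-resolution *)

Section Prefix.
Variables (n : nat) (F : qcnf n).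

(** One filter per block sorts by level and is directly expressible in the machine model. *)
Definition level_sort (s : seq (lit n)) : seq (lit n) :=
  flatten [seq [seq l <- s | l.1 \in B.2] | B : block n <- blocks F].

Hypothesis wf : wf_qcnf F.

Lemma wf_disjoint : pairwise (fun B B' : block n => [disjoint B.2 & B'.2]) (blocks F).
Proof. by case/and4P: wf. Qed.

Lemma mem_level_sort s l : (l \in level_sort s) = (l \in s).
Proof.
apply/flatten_mapP/idP => [[B _]|ls]; first by rewrite mem_filter => /andP[].
have /and4P[_ _ _ /forallP/(_ l.1)/hasP[B BF lB]] := wf.
by exists B; rewrite // mem_filter lB.
Qed.

Lemma level_sort_sorted s : sorted leq (map (lv F) (level_sort s)).
Proof.
rewrite (sorted_pairwise leq_trans) pairwise_map /level_sort /lv.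
elim: (blocks F) wf_disjoint => //= B bs IH /andP[/allP dB /IH{}IH].
rewrite pairwise_cat; apply/and3P; split.
- by apply/allrelP => l k; rewrite mem_filter /= => /andP[-> _].
- elim: s {IH} => //= l s IHs; case: ifP => //= lB; rewrite IHs andbT.
  by apply/allP => k; rewrite /= lB.
apply: (@sub_in_pairwise _ [pred l : lit n | l.1 \notin B.2] _ _ _ _ _ IH).
  by move=> l k /=; rewrite !inE => /negbTE-> /negbTE->.
apply/allP => l /flatten_mapP[B' /dB dBB']; rewrite mem_filter => /andP[lB' _] /=.
by apply/negP => lB; move: dBB' => /disjointFr/(_ lB); rewrite lB'.
Qed.

Lemma level_sort_uniq s : uniq s -> uniq (level_sort s).
Proof.
move=> us; rewrite /level_sort; elim: (blocks F) wf_disjoint => //= B bs IH /andP[/allP dB /IH{}IH].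
rewrite cat_uniq filter_uniq //= IH andbT; apply/hasPn => l /flatten_mapP[B' /dB dBB'].
rewrite mem_filter => /andP[lB' _] /=; rewrite mem_filter negb_and; apply/orP; left.
by apply/negP => lB; move: dBB' => /disjointFr/(_ lB); rewrite lB'.
Qed.

(** As blocks are disjoint, the quantifier can be read off the first block that contains the
    variable, and the level names that block. *)
Lemma existential_lv l k : lv F l = lv F k -> existential F l = existential F k.
Proof.
have /and4P[_ _ _ /forallP hF] := wf.
suff E j : existential F j =
    (nth (false, set0) (blocks F) (find (fun B : block n => j.1 \in B.2) (blocks F))).1.
  by rewrite !E => -[->].
rewrite /existential; have := hF j.1; elim: (blocks F) wf_disjoint => //= B bs IH /andP[/allP dB /IH{}IH].
case: (boolP (j.1 \in B.2)) => //= jB h; last by rewrite andbF IH.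
rewrite andbT; case: (B.1) => //=; apply/hasPn => B' /dB/disjointFr/(_ jB) ->.
by rewrite andbF.
Qed.

End Prefix.

(** * Monotonicity under added clauses *)

Section Extension.
Variable n : nat.
Implicit Types (F G : qcnf n).

Definition extends F G := blocks G = blocks F /\ {subset matrix F <= matrix G}.

Lemma extends_refl F : extends F F.
Proof. by split. Qed.

Lemma extends_trans G F H : extends F G -> extends G H -> extends F H.
Proof. by move=> [e1 s1] [e2 s2]; split; [rewrite e2|move=> C /s1/s2]. Qed.

Lemma extends_learn F C : extends F (learn F C).
Proof. by split=> // D DF; rewrite mem_rcons inE DF orbT. Qed.

Lemma existential_ext F G : blocks G = blocks F -> existential G = existential F.
Proof. by rewrite /existential => ->. Qed.

(** More clauses leave fewer closed sets, so [refuted], [implied] and [absorbed] survive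
    learning. *)
Lemma up_closed_ext F G M : extends F G -> up_closed G M -> up_closed F M.
Proof.
move=> [eb sub] [c1 c2 c3]; split=> // [C /sub|C p /sub CG pC ep]; first exact: c2.
by apply: c3 CG pC _; rewrite (existential_ext eb).
Qed.

Lemma refuted_ext F G A : extends F G -> refuted F A -> refuted G A.
Proof. by move=> e r M /(up_closed_ext e); apply: r. Qed.

Lemma implied_ext F G A l : extends F G -> implied F A l -> implied G A l.
Proof. by move=> e r M /(up_closed_ext e); apply: r. Qed.

Lemma absorbed_ext F G C : extends F G -> absorbed F C -> absorbed G C.
Proof.
move=> e [r i]; split; first exact: refuted_ext r.
move=> l lC; rewrite (existential_ext e.1) => el.
exact: implied_ext (i l lC el).
Qed.

Lemma wf_ext F G : blocks G = blocks F -> wf_qcnf G = wf_qcnf F.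
Proof. by rewrite /wf_qcnf => ->. Qed.

Lemma admissible_ext F G ds : blocks G = blocks F -> admissible F ds -> admissible G ds.
Proof. by rewrite /admissible /existential /lv => ->. Qed.

Lemma admissible_sorted F ds d :
  sorted leq (map (lv F) ds) ->
  existential F d || sorted leq (map (lv F) (rcons ds d)) ->
  admissible F (rcons ds d).
Proof.
move=> sds sd pre x post; case/lastP: post => [|post y].
  by rewrite cats1 => /rcons_inj[<- <-].
rewrite -rcons_cons -rcons_cat => /rcons_inj[E _]; apply/orP; right.
apply: (subseq_sorted leq_trans _ sds); apply: map_subseq.
by rewrite E -cat_rcons prefix_subseq.
Qed.

End Extension.

(* A closed set stays closed when its universal literals outside [A] are dropped. *)
Lemma universal_implied n (F : qcnf n) (A : seq (lit n)) u :
  ~~ existential F u -> u \notin A -> implied F A u -> refuted F A.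
Proof.
move=> nu uA iA M [c1 c2 c3] AM.
have sM l : l \in [set l in M | existential F l || (l \in A)] -> l \in M.
  by rewrite inE => /andP[].
have := iA [set l in M | existential F l || (l \in A)].
rewrite inE (negbTE nu) (negbTE uA) andbF => H; suff: false by []; apply: H; last first.
  by move=> l lA; rewrite inE lA orbT AM.
split.
- by move=> l /sM/c1; apply: contra => /sM.
- by move=> C CF H; apply: (c2 C CF) => l /H/sM.
- move=> C p CF pC ep H; rewrite inE ep andbT.
  by apply: (c3 C) => // l lC lp; apply/sM/H.
Qed.

(** * Tasks, scripts and the simulation for an arbitrary asserting scheme *)

Section Simulation.
Variable xi : scheme.
Hypothesis xiP : asserting_scheme ASS_ORD xi.

Section Rounds.
Variable n : nat.
Implicit Types (F G : qcnf n) (st : qcnf n * seq (round n)) (ds A : seq (lit n)) (C D : clause n).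

(** Every round is followed by a restart, so each trail can be built from scratch. If no conflict
    arises, the list is skipped. *)
Definition sim_step st ds :=
  if attempt st.1 ds is Some T then
    let C := xi st.1 T in (learn st.1 C, rcons st.2 (Round T C 0))
  else st.

Definition simulate := foldl sim_step.

Lemma simulate_cat st s t : simulate st (s ++ t) = simulate (simulate st s) t.
Proof. exact: foldl_cat. Qed.

Lemma sim_step_extends st ds : extends st.1 (sim_step st ds).1.
Proof.
rewrite /sim_step; case: attempt => [T|]; [exact: extends_learn|exact: extends_refl].
Qed.

Lemma simulate_extends st s : extends st.1 (simulate st s).1.
Proof.
elim: s st => [|ds s IH] st; first exact: extends_refl.
exact: extends_trans (sim_step_extends st ds) (IH _).
Qed.

(* If [d] was decided, the trail before it is the least closed superset of [A]; the
   asserted literal is new to it, or the learned clause is already falsified by it. *)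
Lemma sim_step_progress st A d k :
  wf_qcnf st.1 -> admissible st.1 (rcons A d) -> refuted st.1 (rcons A d) -> d \notin A ->
  (forall M, up_closed st.1 M -> {subset A <= M} -> neg d \notin M -> k <= #|M|) ->
  forall M, up_closed (sim_step st (rcons A d)).1 M -> {subset A <= M} ->
    neg d \notin M -> k < #|M|.
Proof.
move=> wf adm ref dA IH M cM AM ndM.
have cM0 := up_closed_ext (sim_step_extends st _) cM.
have dM : d \notin M.
  by apply/negP => dM; apply: (ref M) => // l; rewrite mem_rcons inE => /orP[/eqP->|/AM].
(* If d was not decided, all decisions come from A, and the trail stays inside M. *)
have keyA es ds : attempt_inv st.1 (rcons A d) (ds, es) -> d \notin decisions es ->
    {subset assignment es <= M}.
  move=> [pre [E ok sub _ _]] dn; apply: (trail_sound ok cM0) => l ld.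
  have := mem_subseq sub ld => lpre; have : l \in rcons A d by rewrite E mem_cat lpre.
  by rewrite mem_rcons inE => /orP[/eqP El|/AM//]; rewrite /= El (negbTE dn) in ld.
have keyd es ds : attempt_inv st.1 (rcons A d) (ds, es) -> d \in decisions es ->
    exists s s', es = s ++ Decide d :: s' /\ [/\ trail_ok ASS_ORD st.1 es, decisions s' = [::],
      {subset assignment s <= M}, {subset A <= assignment s}
      & k <= #|[set l in assignment s]|].
  move=> [pre [/= E ok sub _ sp]] /mem_decisions[s [s' Es]]; exists s, s'.
  have [pre1 [pre2 [Epre s1 s2 H]]] := sp _ _ _ Es.
  (* As d is not in A, its only occurrence in the list is the final one: all of A precedes it and no
     decision follows it. *)
  have [Epre1 Epre2] : pre1 = A /\ pre2 = [::].
    move: E; rewrite Epre -catA /=; have [E0|[t [x ->]]] :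
        pre2 ++ ds = [::] \/ exists t x, pre2 ++ ds = rcons t x.
      by case/lastP: (pre2 ++ ds) => [|t x]; [left|right; exists t, x].
    - by rewrite E0 cats1 => /rcons_inj[->]; split=> //; case: (pre2) E0.
    rewrite -rcons_cons -rcons_cat => /rcons_inj[EA _].
    by move: dA; rewrite EA mem_cat mem_head orbT.
  rewrite Epre1 Epre2 in s1 s2 H; rewrite Es in ok.
  have oks := trail_ok_prefix ok.
  have sM : {subset assignment s <= M}.
    by apply: (trail_sound oks cM0) => l /(mem_subseq s1)/AM.
  have As : {subset A <= assignment s}.
    move=> l lA; have /orP[//|/sM nl] := H l lA.
    by case: cM => /(_ l (AM l lA)); rewrite nl.
  have [eok [nf nu]] := ok s (Decide d) s' erefl.
  split=> //; split=> //; first by rewrite Es.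
    by apply/nilP; rewrite /nilp -leqn0; have := size_subseq s2.
  apply: IH; first exact: up_closed_trail oks nf nu.
    by move=> l /As; rewrite inE.
  by rewrite inE; case: eok.
move: cM; rewrite /sim_step; case E: attempt => [T|] /= cM.
- have [cT inv] := attempt_conflict adm E.
  (* A conflict without deciding d would make the closed set M falsify the conflict clause. *)
  case: (boolP (d \in decisions (entries T))) => [dT|/(keyA _ _ inv) TM]; last first.
    case: cT cM0 => _ KF /falsifiedP fK [_ /(_ _ KF)[]] l /fK[nl _].
    exact: TM.
  have [s [s' [Es [ok ds' sM As ks]]]] := keyd _ _ inv dT.
  have [xl xa] := xiP; have CL := xl _ _ _ wf cT.
  have CF : xi st.1 T \in matrix (learn st.1 (xi st.1 T)) by rewrite mem_rcons mem_head.
  case: (xa _ _ _ wf cT) => [||C0]; last first.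
  + by case: cM => _ /(_ _ CF)[]; rewrite C0 => l; rewrite inE.
  + move=> [s1 [d1 [s2 [p [Es1 /unit_underP[ep pC np H]]]]]].
    (* The cut s1 ends right before a decision, and d is the last decision, so s1 is a prefix of s.
       Hence the learned clause forces p in M, while p is not on the trail. *)
    have s1s : {subset assignment s1 <= assignment s}.
      have : size s1 <= size s.
        rewrite leqNgt; apply/negP => lt.
        have : d1 \in decisions s'.
          have /(congr1 (drop (size s).+1)) := Es1; rewrite Es -[s ++ _]cat_rcons.
          rewrite drop_cat size_rcons ltnn subnn drop0 => ->.
          rewrite drop_cat; move: lt; rewrite leq_eqVlt => /orP[/eqP->|->].
            by rewrite ltnn subnn drop0 mem_head.
          by rewrite decisions_cat mem_cat mem_head orbT.
        by rewrite ds'.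
      move=> le l; have /(congr1 (take (size s1))) := Es1; rewrite [RHS]take_size_cat // Es.
      rewrite takel_cat // => <-.
      by rewrite /assignment map_take => /mem_take.
    have npT : neg p \in assignment (entries T) := learnable_falsified cT CL pC.
    have pT : p \notin assignment (entries T).
      by apply/negP => /(trail_consistent ok); rewrite npT.
    have ps : p \notin assignment s.
      by apply: contra pT; rewrite Es /assignment map_cat mem_cat => ->.
    have pM : p \in M.
      case: cM => _ _ /(_ _ p CF pC ep); apply => l lC lp.
      by apply/sM/s1s; case: (H l lC) => _ [El|//]; rewrite El eqxx in lp.
    apply: (leq_ltn_trans ks); apply: proper_card; apply/properP; split.
      by apply/subsetP => l; rewrite inE => /sM.
    by exists p => //; rewrite inE.
  + by exists (last set0 (learnable st.1 T)); split;
      [exact: last_learnable_in|exact: last_learnable_asserting].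
have [es [inv ces]] := attempt_none adm E.
(* Without a conflict the whole assignment is closed. Had d been decided, it would contain both A
   and d, against the hypothesis that they are refuted. *)
case: (boolP (d \in decisions es)) => [des|/(keyA _ _ inv) eM].
  have [s [s' [Es [ok ds' sM As ks]]]] := keyd _ _ inv des.
  case: (ref _ ces) => l; rewrite mem_rcons !inE => /orP[/eqP->|/As ls].
    exact: decisions_sub.
  by rewrite Es /assignment map_cat mem_cat ls.
(* The list is used up, so the variable of d is assigned on a trail inside M, although M has neither
   d nor its negation. *)
have [pre [/= Epre _ _ ass _]] := inv.
have /orP[/eM|/eM] : (d \in assignment es) || (neg d \in assignment es).
- by apply: ass; rewrite cats0 in Epre; rewrite -Epre mem_rcons mem_head.
- by rewrite (negbTE dM).
- by rewrite (negbTE ndM).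
Qed.

(** Each repetition raises by one the least size of a closed set that contains A but not [neg d].
    Such a set also lacks d, so after n repetitions it would be too large to be consistent. *)
Lemma simulate_task st A d :
  wf_qcnf st.1 -> admissible st.1 (rcons A d) -> refuted st.1 (rcons A d) ->
  implied (simulate st (nseq n (rcons A d))).1 A (neg d).
Proof.
move=> wf adm ref; case: (boolP (d \in A)) => [dA|dA].
  move=> M /(up_closed_ext (simulate_extends _ _)) cM AM; case: (ref M cM) => l.
  by rewrite mem_rcons inE => /orP[/eqP->|]; apply: AM.
have prog k : forall M, up_closed (simulate st (nseq k (rcons A d))).1 M ->
    {subset A <= M} -> neg d \notin M -> k <= #|M|.
  elim: k => // k IH; rewrite -addn1 nseqD simulate_cat /=.
  have e := simulate_extends st (nseq k (rcons A d)); rewrite addn1.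
  apply: sim_step_progress IH => //; first by rewrite (wf_ext e.1).
    exact: admissible_ext e.1 adm.
  exact: refuted_ext e ref.
move=> M cM AM; apply/negPn/negP => ndM; have := prog n M cM AM ndM.
rewrite leqNgt (up_closed_card_lt cM _ ndM) //.
apply/negP => dM; apply: (ref M); first exact: up_closed_ext (simulate_extends _ _) cM.
by move=> l; rewrite mem_rcons inE => /orP[/eqP->|/AM].
Qed.

Definition repeat_tasks (ts : seq (seq (lit n))) : seq (seq (lit n)) :=
  flatten [seq nseq n t | t <- ts].

Definition literal_tasks F C : seq (seq (lit n)) :=
  [seq rcons (level_sort F (negs_but C l)) (neg l) | l <- enum C & existential F l].

(* The prefixes are taken from the longest to the shortest one: each of them gets rid of its
   last literal as long as that literal is universal, which ends at [red F C]. *)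
Definition reduction_tasks F C : seq (seq (lit n)) :=
  [seq take j (level_sort F (negs C)) | j <- rev (iota 0 n.+1)].

Definition clause_script F C : seq (seq (lit n)) :=
  repeat_tasks (literal_tasks F C) ++ repeat_tasks (reduction_tasks F C).

(** Fixed in advance from F and pi: the tasks depend on the formula only through its prefix, which
    learning keeps. The final empty list asks for a trail without decisions, whose conflict gives
    the empty clause. *)
Definition script F (pi : seq (clause n)) : seq (seq (lit n)) :=
  rcons (flatten [seq clause_script F C | C <- pi]) [::].

Lemma literal_tasksP F st C : wf_qcnf F -> extends F st.1 -> refuted st.1 (negs C) ->
  absorbed (simulate st (repeat_tasks (literal_tasks F C))).1 C.
Proof.
move=> wf e ref; split; first exact: refuted_ext (simulate_extends _ _) ref.
move=> l lC; rewrite (existential_ext (simulate_extends st _).1) (existential_ext e.1) => el.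
rewrite /literal_tasks; have := lC; rewrite -mem_enum.
elim: (enum C) st e ref => //= k s IH st e ref.
rewrite inE => /orP[/eqP<-|ls].
  rewrite el /repeat_tasks /= simulate_cat.
  apply: implied_ext (simulate_extends _ _) _; rewrite -[l in implied _ _ l]negK => M cM AM.
  apply: (simulate_task _ _ _ cM).
  - by rewrite (wf_ext e.1).
  - apply: (admissible_ext e.1); apply: admissible_sorted; first exact: level_sort_sorted.
    by rewrite existential_neg el.
  - apply: refuted_sub ref => j; rewrite mem_rcons inE mem_level_sort // mem_negs mem_negs_but.
    by case: (eqVneq (neg j) l) => [<- _|_ ->]; rewrite ?negK ?eqxx ?orbT.
  by move=> j; rewrite mem_level_sort // => /AM.
case: ifP => [ek|_]; last exact: IH.
rewrite /repeat_tasks /= simulate_cat; apply: IH => //.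
  exact: extends_trans e (simulate_extends _ _).
exact: refuted_ext (simulate_extends _ _) ref.
Qed.

Lemma reduction_tasksP F st C : wf_qcnf F -> extends F st.1 -> ~~ tautological C ->
  refuted st.1 (negs C) ->
  refuted (simulate st (repeat_tasks (reduction_tasks F C))).1 (negs (red F C)).
Proof.
move=> wf e nt ref; rewrite /reduction_tasks; set L := level_sort F (negs C).
have nt' l : l \in negs C -> neg l \notin negs C.
  rewrite !mem_negs negK => nl; apply/negP => lC; case/negP: nt.
  by apply/existsP; exists l; rewrite lC.
(* A non-tautological clause has at most one literal per variable, so the n+1 prefix lengths in
   [reduction_tasks] cover the whole list. *)
have uL : uniq [seq l.1 | l <- L].
  rewrite map_inj_in_uniq; last first.
    move=> l k; rewrite !mem_level_sort // => lC kC /eq_var[//|E].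
    by have := nt' k kC; rewrite -E lC.
  by apply: level_sort_uniq => //; rewrite map_inj_uniq ?enum_uniq //; apply: can_inj (@negK n).
have sL : size L <= n.
  rewrite -(size_map fst) -(card_uniqP uL) -[X in _ <= X]card_ord; exact: max_card.
suff H m st' : extends F st'.1 -> refuted st'.1 (take m L) ->
    refuted (simulate st' (repeat_tasks [seq take j L | j <- rev (iota 0 m.+1)])).1
            (negs (red F C)).
  apply: H e _; apply: refuted_sub ref => l.
  by rewrite take_oversize // mem_level_sort.
have iotaS i : rev (iota 0 i.+1) = i :: rev (iota 0 i).
  by rewrite -addn1 iotaD rev_cat.
elim: m st' => [|m IH] st' e' ref'.
  by apply: refuted_ext (simulate_extends _ _) _; apply: refuted_sub ref' => l; rewrite take0.
rewrite iotaS /= /repeat_tasks /= -/(repeat_tasks _) simulate_cat.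
have e2 := extends_trans e' (simulate_extends st' (nseq n (take m.+1 L))).
(* Beyond the length of the list, shortening the prefix changes nothing. *)
case: (leqP (size L) m) => [le|lt].
  apply: IH e2 _; apply: refuted_ext (simulate_extends _ _) _.
  by apply: refuted_sub ref' => l; rewrite !take_oversize // ltnW.
have [l0 _] : exists l : lit n, true by case: (L) lt => // l *; exists l.
set d := nth l0 L m; have Etake : take m.+1 L = rcons (take m L) d by rewrite (take_nth l0).
have subL j k : k \in take j L -> k \in negs C by move=> /mem_take; rewrite mem_level_sort.
have sorted_take j : sorted leq (map (lv F) (take j L)).
  by rewrite map_take; apply: take_sorted; apply: level_sort_sorted.
have ltd : {in take m L, forall k, lv F k <= lv F d}.
  have := sorted_take m.+1; rewrite Etake map_rcons (sorted_pairwise leq_trans) pairwise_rcons.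
  by move=> /andP[/allP H _] k /(map_f (lv F))/H.
have dC : d \in negs C by apply: (subL m.+1); rewrite Etake mem_rcons mem_head.
(* An existential d ends the reduction: a universal literal before it has a strictly smaller level,
   since equal levels share a quantifier. So the prefix negates only literals of [red F C], and the
   remaining tasks merely add clauses. *)
case: (boolP (existential F d)) => [ed|ud].
  apply: refuted_ext (simulate_extends _ _) _; apply: refuted_ext (simulate_extends _ _) _.
  apply: refuted_sub ref' => l lt'; rewrite mem_negs inE -mem_negs (subL _ _ lt') /=.
  rewrite /reducible existential_neg; case: (boolP (existential F l)) => //= ul.
  apply/forallPn; exists (neg d); rewrite -mem_negs dC /= existential_neg ed /= -ltnNge !lv_neg.
  move: lt'; rewrite Etake mem_rcons inE => /orP[/eqP El|/ltd]; first by rewrite El ed in ul.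
  rewrite leq_eqVlt => /orP[/eqP/(existential_lv wf)|//].
  by rewrite ed (negbTE ul).
(* For a universal d the task forces [neg d] from the shorter prefix, which is therefore refuted by
   itself. *)
apply: IH e2 _; rewrite Etake in ref' *.
apply: (@universal_implied _ _ _ (neg d)).
- by rewrite (existential_ext (simulate_extends _ _).1) (existential_ext e'.1) existential_neg.
- by apply/negP => /subL; apply/negP/nt'.
apply: simulate_task ref'; first by rewrite (wf_ext e'.1).
apply: (admissible_ext e'.1); apply: admissible_sorted; first exact: sorted_take.
by rewrite -Etake sorted_take orbT.
Qed.

Lemma mem_matrix_absorbed F C : C \in matrix F -> absorbed F C.
Proof.
move=> CF; split=> [M [_ c _] AM|l lC el M [_ _ c] AM].
  by apply: (c C CF) => k kC; apply: AM; rewrite mem_negs negK.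
by apply: (c C) => // k kC kl; apply: AM; rewrite mem_negs_but negK kC.
Qed.

(** A closed set that falsifies the resolvent would get l from D and its negation from E. *)
Lemma resolvent_refuted F D (E : clause n) l : existential F l -> l \in D -> neg l \in E ->
  absorbed F D -> absorbed F E -> refuted F (negs (resolvent D E l)).
Proof.
move=> el lD lE [_ aD] [_ aE] M cM AM.
have lM : l \in M.
  apply: (aD l lD el M cM) => k; rewrite mem_negs_but => /andP[kD kl].
  by apply: AM; rewrite mem_negs !inE kD kl.
have nlM : neg l \in M.
  apply: (aE _ lE el M cM) => k; rewrite mem_negs_but => /andP[kE kl].
  by apply: AM; rewrite mem_negs !inE kE kl orbT.
by case: cM => /(_ l lM); rewrite nlM.
Qed.

(** Both conclusions are consumed later: a resolution step uses that its premises are absorbed, a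
    reduction step that [red F D] cannot be falsified, since its conclusion contains [red F D]. *)
Lemma simulate_lines F st pi : wf_qcnf F -> extends F st.1 ->
  (forall s C s', pi = s ++ C :: s' -> qres_line F s C) ->
  forall C, C \in pi ->
    let G := (simulate st (flatten [seq clause_script F D | D <- pi])).1 in
    absorbed G C /\ refuted G (negs (red F C)).
Proof.
move=> wf e; elim/last_ind: pi => // pi C IH H D.
have {}IH := IH (fun s E s' E' => H s E (rcons s' C) (etrans (congr1 (rcons^~ C) E') (rcons_cat _ _ _))).
rewrite map_rcons flatten_rcons simulate_cat /=.
set st1 := simulate st _ in IH *; set st2 := simulate st1 _.
have e12 : extends st1.1 st2.1 by exact: simulate_extends.
have e1 : extends F st1.1 := extends_trans e (simulate_extends _ _).
rewrite mem_rcons inE => /orP[/eqP->{D}|/IH[aD rD]]; last first.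
  by split; [exact: absorbed_ext aD|exact: refuted_ext rD].
have [nt line] := H pi C [::] (esym (cats1 _ _)).
have ref : refuted st1.1 (negs C).
  case: line => [CF|[D [E [l [Dp Ep el lD [lE ->]]]]]|[D [Dp rDC _]]].
  - by have [] := mem_matrix_absorbed (e1.2 _ CF).
  - have [aD _] := IH D Dp; have [aE _] := IH E Ep.
    by apply: resolvent_refuted; rewrite ?(existential_ext e1.1).
  have [_ rD] := IH D Dp; apply: refuted_sub rD => k; rewrite !mem_negs.
  exact: (subsetP rDC).
have aC := literal_tasksP wf e1 ref.
rewrite /st2 /clause_script simulate_cat; split.
  exact: absorbed_ext (simulate_extends _ _) aC.
apply: reduction_tasksP => //; first exact: extends_trans e1 (simulate_extends _ _).
exact: refuted_ext (simulate_extends _ _) ref.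
Qed.

Definition after F (iota : seq (round n)) : qcnf n :=
  foldl (fun G R => learn G (learned R)) F iota.

Definition restarts (iota : seq (round n)) := all (fun R => backtrack R == 0) iota.

(** Appending a round creates a backtracking condition for the round that used to be last. With
    restarts it is vacuous, as no entries are kept. *)
Lemma derivation_rcons F iota R : restarts (rcons iota R) ->
  qcdcl_derivation ASS_ORD F iota -> conflict_trail ASS_ORD (after F iota) (round_trail R) ->
  learned R \in learnable (after F iota) (round_trail R) ->
  qcdcl_derivation ASS_ORD F (rcons iota R).
Proof.
elim: iota F => /= [|R0 iota IH] F.
  by rewrite andbT => /eqP R0 _ cT lR; split=> //; split=> //; rewrite R0.
case/andP => /eqP b0 rs [cT lR _ dv] cR leR; split=> //; last exact: IH.
by rewrite /backtracks b0; split=> //; case: (iota) => *; rewrite /= !take0.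
Qed.

Lemma uses_scheme_rcons F iota R : uses_scheme xi F iota ->
  learned R = xi (after F iota) (round_trail R) -> uses_scheme xi F (rcons iota R).
Proof.
elim: iota F => /= [|R0 iota IH] F; first by move=> _ ->.
by move=> [E us] lR; split=> //; apply: IH.
Qed.

Definition sim_inv F st := [/\ st.1 = after F st.2, restarts st.2,
  qcdcl_derivation ASS_ORD F st.2 & uses_scheme xi F st.2].

Lemma after_blocks F iota : blocks (after F iota) = blocks F.
Proof. by elim: iota F => //= R iota IH F; rewrite IH. Qed.

Lemma sim_step_inv F st ds : wf_qcnf F -> admissible F ds -> sim_inv F st ->
  sim_inv F (sim_step st ds) /\
  qcdcl_size (sim_step st ds).2 <= qcdcl_size st.2 + n.+1.
Proof.
move=> wf adm; case: st => G rs [/= EG rst dv us]; rewrite /sim_step /=.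
case E: attempt => [T|]; last by split=> //; rewrite leq_addr.
have bG : blocks G = blocks F by rewrite EG after_blocks.
have [cT _] := attempt_conflict (admissible_ext bG adm) E.
have wfG : wf_qcnf G by rewrite (wf_ext bG).
split; last first.
  rewrite /qcdcl_size big_rcons leq_add2l ltnS; apply: (@trail_size _ ASS_ORD G).
  by case: cT.
have lT := xiP.1 _ _ _ wfG cT.
have rst' : restarts (rcons rs (Round T (xi G T) 0)) by rewrite /restarts all_rcons.
split=> //=.
- by rewrite /after foldl_rcons -/(after F rs) -EG.
- by apply: derivation_rcons => //; rewrite -EG.
- by apply: uses_scheme_rcons => //=; rewrite -EG.
Qed.

Lemma simulate_inv F st s : wf_qcnf F -> {in s, forall ds, admissible F ds} ->
  sim_inv F st -> sim_inv F (simulate st s) /\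
  qcdcl_size (simulate st s).2 <= qcdcl_size st.2 + size s * n.+1.
Proof.
move=> wf; elim: s st => [|ds s IH] st adm inv /=; first by rewrite addn0.
have [inv1 sz1] := sim_step_inv wf (adm ds (mem_head _ _)) inv.
have [|inv2 sz2] := IH _ _ inv1; first by move=> t ts; apply: adm; rewrite inE ts orbT.
by split=> //; apply: leq_trans sz2 _; rewrite mulSn addnA leq_add2r.
Qed.

Lemma admissible_of_sorted F ds : sorted leq (map (lv F) ds) -> admissible F ds.
Proof.
move=> sds pre d post E; apply/orP; right.
apply: (subseq_sorted leq_trans _ sds); apply: map_subseq.
by rewrite E -cat_rcons prefix_subseq.
Qed.

Lemma script_admissible F pi : wf_qcnf F -> {in script F pi, forall ds, admissible F ds}.
Proof.
move=> wf ds; rewrite mem_rcons inE => /orP[/eqP->|]; first exact: admissible_of_sorted.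
have rep ts : ds \in repeat_tasks ts -> ds \in ts.
  by case/flatten_mapP => t tts; rewrite mem_nseq => /andP[_ /eqP->].
case/flatten_mapP => C _; rewrite mem_cat => /orP[/rep/mapP[l]|/rep/mapP[j _ ->]].
  rewrite mem_filter => /andP[el _] ->; apply: admissible_sorted; first exact: level_sort_sorted.
  by rewrite existential_neg el.
by apply: admissible_of_sorted; rewrite map_take take_sorted // level_sort_sorted.
Qed.

Lemma size_repeat_tasks ts : size (repeat_tasks ts) = size ts * n.
Proof. by rewrite /repeat_tasks; elim: ts => //= t ts IH; rewrite size_cat size_nseq IH. Qed.

(** There are at most 2n literal tasks and n+1, hence at most 2n, reduction tasks, each repeated n
    times. *)
Lemma size_clause_script F C : 0 < n -> size (clause_script F C) <= 4 * n ^ 2.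
Proof.
move=> n0; rewrite size_cat !size_repeat_tasks !size_map size_rev size_iota -mulnDl.
rewrite (_ : 4 * n ^ 2 = (n * 2 + (n + n)) * n); last by rewrite -mulnn; lia.
rewrite leq_mul2r; apply/orP; right; apply: leq_add; last by rewrite -addn1 leq_add2l.
rewrite size_filter (leq_trans (count_size _ _)) // -cardE.
by rewrite (leq_trans (max_card _)) // card_prod card_ord card_bool.
Qed.

Lemma size_script F pi : 0 < n -> size (script F pi) <= (size pi * (4 * n ^ 2)).+1.
Proof.
move=> n0; rewrite size_rcons ltnS; elim: pi => //= C pi IH.
by rewrite size_cat mulSn leq_add // size_clause_script.
Qed.

Theorem simulate_refutation F pi : wf_qcnf F -> qres_refutation F pi ->
  let iota := (simulate (F, [::]) (script F pi)).2 in
  [/\ qcdcl_refutation ASS_ORD F iota, uses_scheme xi F iota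
    & 0 < n -> qcdcl_size iota <= 10 * (n ^ 3 * size pi)].
Proof.
move=> wf [lines [s Epi]] /=.
have [|[_ _ dv us] sz] := @simulate_inv F (F, [::]) (script F pi) wf (@script_admissible F pi wf).
  by [].
split=> //.
- split=> //; rewrite /script -cats1 simulate_cat.
  have [|[aE _] _] := simulate_lines wf (extends_refl F : extends F (F, [::]).1) lines (_ : set0 \in pi).
    by rewrite Epi mem_rcons mem_head.
  set st := simulate _ _ in aE *; rewrite /= /sim_step.
  have e : extends F st.1 by exact: (simulate_extends (F, [::])).
  have adm : admissible st.1 [::] by exact: admissible_of_sorted.
  (* The absorbed empty clause excludes every closed set, so the attempt without decisions must end
     in a conflict. *)
  case E: attempt => [T|]; last first.
    have [es [_ ces]] := attempt_none adm E.
    by case: (aE _ ces) => l; rewrite mem_negs inE.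
  exists st.2, (Round T (xi st.1 T) 0); split=> //=.
  have [cT [pre [Epre _ sub _ _]]] := attempt_conflict adm E.
  have wf1 : wf_qcnf st.1 by rewrite (wf_ext e.1).
  (* An asserting clause needs a decision to cut at. The trail has none, so the scheme returns the
     empty clause. *)
  have [|[s1 [d [s2 [p [ET _]]]]]|//] := xiP.2 _ _ _ wf1 cT.
    by exists (last set0 (learnable st.1 T)); split;
      [exact: last_learnable_in|exact: last_learnable_asserting].
  case: pre Epre sub => //= _; rewrite ET decisions_cat /=.
  by case: (decisions s1).
move=> n0; apply: leq_trans sz _; rewrite /qcdcl_size big_nil add0n.
apply: leq_trans (leq_mul (size_script F pi n0) (leqnn _)) _.
have p0 : 0 < size pi by rewrite Epi size_rcons.
(* With m lines there are at most 4mn^2 + 1 trails of length at most n + 1, that is at most 2n. The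
   product is at most 8mn^3 + 2n, and m is positive; hence the 10. *)
rewrite !expnS expn0; nia.
Qed.

End Rounds.
End Simulation.

Definition last_scheme : scheme := fun n F T => last set0 (learnable F T).

Lemma last_scheme_asserting : asserting_scheme ASS_ORD last_scheme.
Proof.
split=> n F T wf cT *; first exact: last_learnable_in.
exact: last_learnable_asserting.
Qed.

(** * From QCDCL to Q-resolution *)

Section ReadOff.
Variables (n : nat) (F : qcnf n).
Implicit Types (C D : clause n) (prev pi : seq (clause n)).

(** The antecedent is written down before each resolution. It is an axiom or was learned earlier; in
    the second case it is repeated by a reduction that deletes nothing. *)
Definition line_step (st : clause n * seq (clause n)) (e : entry n) :=
  match e with
  | Decide _ => st
  | Propagate p D =>
      if neg p \in st.1 then
        let R := resolvent (red F D) st.1 p in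
        (red F R, st.2 ++ [:: D; red F D; R; red F R])
      else st
  end.

Definition trail_lines es (K : clause n) : seq (clause n) :=
  (foldl line_step (red F K, [:: K; red F K]) (rev es)).2.

Definition round_lines (R : round n) : seq (clause n) :=
  trail_lines (entries (round_trail R)) (conflict (round_trail R)).

(** The empty clause is appended because the lines of a round follow the whole learning process, and
    so need not end with the clause that was learned. *)
Definition qres_lines (iota : seq (round n)) : seq (clause n) :=
  rcons (flatten [seq round_lines R | R <- iota]) set0.

Definition qres_from prev pi : Prop :=
  forall s C s', pi = s ++ C :: s' -> qres_line F (prev ++ s) C.

Lemma qres_from_nil prev : qres_from prev [::].
Proof. by case. Qed.

Lemma qres_from_cat prev s t :
  qres_from prev s -> qres_from (prev ++ s) t -> qres_from prev (s ++ t).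
Proof.
elim: s prev => [|D s IH] prev Hs Ht; first by rewrite cats0 in Ht.
move=> [|E r] C s' /= [E1 E2]; first by apply: (Hs [::] C s); rewrite E1.
rewrite -E1 -cat_rcons; apply: IH E2; last by rewrite cat_rcons.
by move=> r' C' s'' Es; rewrite cat_rcons; apply: (Hs (D :: r') C' s''); rewrite Es.
Qed.

Lemma qres_from_cons prev C pi :
  qres_line F prev C -> qres_from (rcons prev C) pi -> qres_from prev (C :: pi).
Proof.
move=> lC H; apply: (@qres_from_cat _ [:: C]); last by rewrite cats1.
by move=> [|? []] D s'//= [<- _]; rewrite cats0.
Qed.

Lemma line_again prev C : ~~ tautological C -> C \in prev -> qres_line F prev C.
Proof. by move=> nt Cp; split=> //; apply: Or33; exists C; rewrite red_subset. Qed.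

Lemma line_red prev C : ~~ tautological C -> C \in prev -> qres_line F prev (red F C).
Proof.
move=> nt Cp; split; last by apply: Or33; exists C; rewrite red_subset.
apply: contra nt => /existsP[l /andP[/(subsetP (red_subset F C)) lC /(subsetP (red_subset F C)) nl]].
by apply/existsP; exists l; rewrite lC.
Qed.

Lemma falsified_nontautological P G es C : trail_ok P G es ->
  (forall l, l \in C -> neg l \in assignment es) -> ~~ tautological C.
Proof.
move=> ok H; apply/existsP => -[l /andP[/H nl /H]]; rewrite negK => ll.
by have := trail_consistent ok ll; rewrite nl.
Qed.

Definition available prev C := (C \in matrix F) || (C \in prev).

Lemma line_available prev C : ~~ tautological C -> available prev C -> qres_line F prev C.
Proof.
by move=> nt /orP[CF|]; [split=> //; apply: Or31|exact: line_again].
Qed.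

(** The lines are produced in step with [learn_step], so every learnable clause occurs among them.
    The trail falsifies each of these clauses, which keeps them free of tautologies. *)
Lemma line_steps P G s t prev C ls : blocks G = blocks F ->
  {in matrix G, forall D, available prev D} -> trail_ok P G (s ++ t) ->
  qres_from prev ls -> C \in prev ++ ls ->
  (forall l, l \in C -> neg l \in assignment (s ++ t)) ->
  let res := (foldl line_step (C, ls) (rev s)).2 in
  qres_from prev res /\ {subset C :: scanl (learn_step G) C (rev s) <= prev ++ res}.
Proof.
move=> bG av; elim/last_ind: s t C ls => [|s e IH] t C ls ok qls Cin fC /=.
  by split=> // D; rewrite inE => /eqP->.
rewrite rev_rcons /=; rewrite cat_rcons in ok fC.
have eqG : red G = red F by rewrite /red /reducible /existential /lv bG.
have [eok _] := ok s e t erefl.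
have finish C' ls' : C' = learn_step G C e -> {subset ls <= ls'} ->
    qres_from prev ls' -> C' \in prev ++ ls' ->
    (forall l, l \in C' -> neg l \in assignment (s ++ e :: t)) ->
    let res := (foldl line_step (C', ls') (rev s)).2 in
    qres_from prev res /\
    {subset [:: C, learn_step G C e & scanl (learn_step G) (learn_step G C e) (rev s)]
       <= prev ++ res}.
  move=> -> sub qls' Cin' fC' /=; have [q1 q2] := IH (e :: t) _ _ ok qls' Cin' fC'.
  split=> // D; rewrite inE => /orP[/eqP->|/q2//].
  have mono st s0 : {subset st.2 <= (foldl line_step st s0).2}.
    elim: s0 st => [|e0 s0 IH0] st D0 D0in //=; apply: IH0.
    by case: e0 => //= p0 E0; case: ifP => // _; rewrite mem_cat D0in.
  move: Cin; rewrite !mem_cat => /orP[->//|/sub/(mono (_, _))-> ].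
  by rewrite orbT.
case: e eok ok finish fC => [d|p D] eok ok finish fC; first exact: finish.
case: eok => DG /unit_underP[ep pD np HD].
rewrite [line_step _ (Propagate p D)]/=; case: ifP => npC; last first.
  by apply: finish => //=; rewrite npC.
set R := resolvent _ _ _.
have fD l : l \in D -> l != p -> neg l \in assignment (s ++ Propagate p D :: t).
  move=> lD lp; rewrite /assignment map_cat mem_cat; case: (HD l lD) => _ [E|->//].
  by rewrite E eqxx in lp.
have fR l : l \in R -> neg l \in assignment (s ++ Propagate p D :: t).
  by rewrite !inE => /orP[/and3P[lp lD _]|/andP[_ /fC//]]; apply: fD.
have ntR : ~~ tautological R by apply: falsified_nontautological ok fR.
(* In an antecedent only p itself escapes falsification by the trail before it, and the negation of
   p in D would have to be falsified by p before p was assigned. *)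
have ntD : ~~ tautological D.
  apply/existsP => -[l /andP[lD nlD]].
  wlog lp : l lD nlD / l != p => [H|].
    case: (eqVneq l p) => [E|]; last exact: H.
    by apply: (H (neg l)); rewrite ?negK // E neg_eq.
  have lT := fD l lD lp; case: (eqVneq (neg l) p) => [E|nlp].
    case: (HD _ lD) => _ [E'|nl]; first by rewrite E' eqxx in lp.
    by case: (HD _ nlD); rewrite nl.
  by have := trail_consistent ok lT; rewrite fD.
have pR : p \in red F D by rewrite in_red_existential // -(existential_ext bG).
apply: finish.
- by rewrite /= npC eqG.
- by move=> E Els; rewrite mem_cat Els.
- apply: qres_from_cat => //; apply: qres_from_cons.
    apply: line_available => //; have /orP[DF|Dp] := av D DG; rewrite /available ?DF //.
    by rewrite mem_cat Dp orbT.
  apply: qres_from_cons; first by apply: line_red; rewrite // mem_rcons mem_head.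
  apply: qres_from_cons.
    split=> //; apply: Or32; exists (red F D), C, p; split=> //.
    - by rewrite mem_rcons mem_head.
    - by rewrite !(mem_rcons, inE) Cin !orbT.
    by rewrite -(existential_ext bG).
  apply: qres_from_cons; first by apply: line_red; rewrite // mem_rcons mem_head.
  exact: qres_from_nil.
- by rewrite !mem_cat !inE eqxx !orbT.
by move=> l /(subsetP (red_subset _ _))/fR.
Qed.

Lemma round_linesP P G prev T C b : blocks G = blocks F ->
  {in matrix G, forall D, available prev D} -> conflict_trail P G T ->
  qres_from prev (round_lines (Round T C b)) /\
  {subset learnable G T <= prev ++ round_lines (Round T C b)}.
Proof.
case: T => es K bG av [ok KG /falsifiedP fK].
have eqG : red G = red F by rewrite /red /reducible /existential /lv bG.
have fK' l : l \in K -> neg l \in assignment es by move=> /fK[].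
have nK := falsified_nontautological ok fK'.
rewrite /learnable /= eqG.
apply: (@line_steps P G es [::]); rewrite ?cats0 //.
- apply: qres_from_cons; first by apply: line_available => //; apply: av.
  apply: qres_from_cons; first by apply: line_red; rewrite // mem_rcons mem_head.
  exact: qres_from_nil.
- by rewrite mem_cat !inE eqxx !orbT.
by move=> l /(subsetP (red_subset _ _))/fK'.
Qed.

Lemma round_lines_flatten P G prev iota : blocks G = blocks F ->
  {in matrix G, forall D, available prev D} -> qcdcl_derivation P G iota ->
  qres_from prev (flatten [seq round_lines R | R <- iota]) /\
  (forall R, R \in [seq learned R | R <- iota] ->
     R \in prev ++ flatten [seq round_lines R | R <- iota]).
Proof.
elim: iota G prev => [|R iota IH] G prev bG av /=; first by split=> //; exact: qres_from_nil.
case=> cT lR _ dv; case: R cT lR dv => T C b /= cT CT dv.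
have [q1 q2] := round_linesP C b bG av cT.
have [||q3 q4] := IH _ (prev ++ round_lines (Round T C b)) _ _ dv => //.
  move=> D; rewrite mem_rcons inE => /orP[/eqP->|/av/orP[DF|Dp]]; rewrite /available.
  - by rewrite q2 ?orbT.
  - by rewrite DF.
  - by rewrite mem_cat Dp orbT.
split; first exact: qres_from_cat.
move=> D; rewrite inE => /orP[/eqP->|/q4]; last by rewrite catA.
by rewrite catA mem_cat q2.
Qed.

Theorem qres_lines_refutation P iota : qcdcl_refutation P F iota ->
  qres_refutation F (qres_lines iota).
Proof.
case=> dv [s [R [E R0]]]; split; last by exists (flatten [seq round_lines R | R <- iota]).
have [|q1 q2] := @round_lines_flatten P F [::] iota erefl _ dv.
  by move=> D DF; rewrite /available DF.
suff H : qres_from [::] (qres_lines iota) by move=> t C t' /H.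
rewrite /qres_lines -cats1; apply: qres_from_cat => //.
apply: qres_from_cons; last exact: qres_from_nil.
apply: line_again; first by apply/existsP => -[l]; rewrite inE.
by apply: q2; rewrite E map_rcons mem_rcons R0 mem_head.
Qed.

End ReadOff.

Lemma qcdcl_ass_any n (F : qcnf n) iota :
  qcdcl_refutation ASS_ORD F iota -> qcdcl_refutation ANY_ORD F iota.
Proof.
case=> dv last; split=> //; elim: iota F dv {last} => //= R iota IH F [[ok KF fK] lR bt /IH dv].
split=> //; split=> // s e s' /ok[eok nat]; split=> //.
by case: e eok {nat} => // d [].
Qed.

(** * Polynomial time *)

Definition encoder (A : nat -> Type) := forall n, A n -> tree.

(** One constant serves as factor and exponent, as in [p_simulates]. Trees have size at least 1, so
    such bounds are closed under sums and products. *)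
Definition poly_bounded A (eA : encoder A) (h : forall n, A n -> nat) : Prop :=
  exists k, forall n x, h n x <= k * tree_size (eA n x) ^ k.

Definition runs p x y b := exists2 t, run p x y t & t <= b.

(* The program is uniform in the number [n] of variables. *)
Definition polytime A B (eA : encoder A) (eB : encoder B) (f : forall n, A n -> B n) :=
  exists p, exists2 h, poly_bounded eA h
    & forall n x, runs p (eA n x) (eB n (f n x)) (h n x).

Lemma tree_size_gt0 t : 0 < tree_size t.
Proof. by case: t. Qed.

(** As reading is charged, the cost bounds the size of the output, so polynomial-time functions have
    outputs of polynomial size without further analysis. *)
Lemma run_size p x y t : run p x y t -> tree_size x <= t /\ tree_size y <= t.
Proof.
elim=> {p x y t} /=; try (by move=> *; lia).
- by move=> x; have := tree_size_gt0 x; lia.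
- by move=> [|a b] /=; lia.
- by move=> [|a b] /=; lia.
move=> [|a b] //=; have := tree_size_gt0 a; have := tree_size_gt0 b.
by case: (tree_eq a b) => /=; lia.
Qed.

Lemma tree_eqP s t : tree_eq s t = true <-> s = t.
Proof.
split=> [|->]; last by elim: t => //= a -> b ->.
by elim: s t => [|a IHa b IHb] [|c d] //= /andP[/IHa-> /IHb->].
Qed.

Section Runs.
Variables (p q r : prog).

Lemma runs_le x y b b' : b <= b' -> runs p x y b -> runs p x y b'.
Proof. by move=> le [t rt tb]; exists t => //; apply: leq_trans le. Qed.

Lemma runs_seq x y z b c : runs p x y b -> runs q y z c -> runs (Seq p q) x z (b + c).+1.
Proof. by move=> [s rs sb] [t rt tc]; exists (s + t).+1; [apply: run_seq rs rt|lia]. Qed.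

Lemma runs_pair x y z b c :
  runs p x y b -> runs q x z c -> runs (Pair p q) x (Node y z) (b + c).+1.
Proof. by move=> [s rs sb] [t rt tc]; exists (s + t).+1; [apply: run_pair|lia]. Qed.

Lemma runs_if x c y b d : runs r x c b ->
  runs (if c is Node _ _ then p else q) x y d -> runs (If r p q) x y (b + d).+1.
Proof.
move=> [s rs sb] [t + tc] => rt; exists (s + t).+1; last lia.
by case: c rs rt => [|u v] rs rt; [apply: run_if_false rt|apply: run_if_true rs rt].
Qed.

Lemma runs_while_stop x b : runs p x Leaf b -> runs (While p q) x x b.+1.
Proof. by move=> [s rs sb]; exists s.+1 => //; apply: run_while_stop. Qed.

Lemma runs_while_step x u v y z b c d : runs p x (Node u v) b -> runs q x y c ->
  runs (While p q) y z d -> runs (While p q) x z (b + c + d).+1.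
Proof.
move=> [s1 r1 l1] [s2 r2 l2] [s3 r3 l3].
by exists (s1 + s2 + s3).+1; [apply: run_while_step r1 r2 r3|lia].
Qed.

End Runs.

Lemma runs_id x : runs Id x x (tree_size x).
Proof. by exists (tree_size x) => //; apply: run_id. Qed.

Lemma runs_nil x : runs Defs.Nil x Leaf (tree_size x).
Proof. by exists (tree_size x) => //; apply: run_nil. Qed.

Lemma runs_head a b : runs Head (Node a b) a (tree_size (Node a b)).
Proof. by exists (tree_size (Node a b)) => //; apply: (run_head (Node a b)). Qed.

Lemma runs_tail a b : runs Tail (Node a b) b (tree_size (Node a b)).
Proof. by exists (tree_size (Node a b)) => //; apply: (run_tail (Node a b)). Qed.

Lemma runs_eq a b : runs Defs.Eq (Node a b) (tree_of_bool (tree_eq a b)) (tree_size (Node a b)).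
Proof. by exists (tree_size (Node a b)) => //; apply: (run_eq (Node a b)). Qed.

(** * Calculus of polynomial bounds *)

Section PolyBounded.
Variables (A : nat -> Type) (eA : encoder A).
Arguments eA : clear implicits.
Implicit Types g h : forall n, A n -> nat.

Lemma poly_le g h : (forall n x, h n x <= g n x) -> poly_bounded eA g -> poly_bounded eA h.
Proof. by move=> le [k H]; exists k => n x; apply: leq_trans (le n x) (H n x). Qed.

Lemma poly_const c : poly_bounded eA (fun _ _ => c).
Proof. by exists c => n x; rewrite leq_pmulr // expn_gt0 tree_size_gt0. Qed.

Lemma poly_size : poly_bounded eA (fun n x => tree_size (eA n x)).
Proof. by exists 1 => n x; rewrite mul1n expn1. Qed.

Lemma poly_add g h : poly_bounded eA g -> poly_bounded eA h ->
  poly_bounded eA (fun n x => g n x + h n x).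
Proof.
move=> [k Hk] [l Hl]; exists (k + l) => n x; rewrite mulnDl.
have m0 := tree_size_gt0 (eA n x).
apply: leq_add.
  by apply: leq_trans (Hk n x) _; rewrite leq_mul // leq_pexp2l // leq_addr.
by apply: leq_trans (Hl n x) _; rewrite leq_mul // leq_pexp2l // leq_addl.
Qed.

Lemma poly_mul g h : poly_bounded eA g -> poly_bounded eA h ->
  poly_bounded eA (fun n x => g n x * h n x).
Proof.
move=> [k Hk] [l Hl]; exists (k * l + (k + l)) => n x.
apply: leq_trans (leq_mul (Hk n x) (Hl n x)) _.
have m0 := tree_size_gt0 (eA n x).
rewrite mulnACA -expnD leq_mul // ?leq_addr // leq_pexp2l // leq_addl //.
Qed.

Lemma poly_exp h k : poly_bounded eA h -> poly_bounded eA (fun n x => h n x ^ k).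
Proof.
move=> Hh; elim: k => [|k IH]; first exact: poly_const 1.
by apply: poly_le (poly_mul Hh IH) => n x; rewrite expnS.
Qed.

End PolyBounded.

Lemma poly_succ A (eA : encoder A) h : poly_bounded eA h ->
  poly_bounded eA (fun n x => (h n x).+1).
Proof.
by move=> Hh; apply: poly_le (poly_add Hh (poly_const eA 1)) => n x; rewrite addn1.
Qed.

Ltac poly_bound := repeat first [ assumption | exact: poly_const | exact: poly_size
  | apply: poly_exp | apply: poly_mul | apply: poly_add | apply: poly_succ ].

Lemma leq_exp k m m' : m <= m' -> m ^ k <= m' ^ k.
Proof. by case: k => // k le; rewrite leq_exp2r. Qed.

Definition eTree : encoder (fun=> tree) := fun _ t => t.
Arguments eTree : clear implicits.

Definition ePair B C (eB : encoder B) (eC : encoder C) : encoder (fun n => (B n * C n)%type) :=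
  fun n z => Node (eB n z.1) (eC n z.2).
Arguments ePair {B C} eB eC n z.

Definition eBool : encoder (fun=> bool) := fun _ => tree_of_bool.
Arguments eBool : clear implicits.

Definition eSeq B (eB : encoder B) : encoder (fun n => seq (B n)) :=
  fun n => tree_of_seq (eB n).
Arguments eSeq {B} eB n _.

(** * Combinators and loops *)

Section Closure.
Variables (A : nat -> Type) (eA : encoder A).
Arguments eA : clear implicits.

Lemma poly_comp B (eB : encoder B) (h : forall n, B n -> nat) (g : forall n, A n -> nat)
    (f : forall n, A n -> B n) :
  poly_bounded eB h -> (forall n x, tree_size (eB n (f n x)) <= g n x) ->
  poly_bounded eA g -> poly_bounded eA (fun n x => h n (f n x)).
Proof.
move=> [k Hk] le Hg; apply: poly_le (poly_mul (poly_const eA k) (poly_exp k Hg)) => n x.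
by apply: leq_trans (Hk _ _) _; rewrite leq_mul2l leq_exp ?le ?orbT.
Qed.

Lemma polytime_output B (eB : encoder B) f : polytime eA eB f ->
  poly_bounded eA (fun n x => tree_size (eB n (f n x))).
Proof.
move=> [p [h Hh r]]; apply: poly_le Hh => n x; have [t rt th] := r n x.
by have [_ le] := run_size rt; apply: leq_trans th.
Qed.

(** Only the codes matter to a program, so f and g may have different types. This is how structured
    data are treated as pairs and lists. *)
Lemma polytime_recode B C (eB : encoder B) (eC : encoder C) f g :
  (forall n x, eC n (g n x) = eB n (f n x)) -> polytime eA eB f -> polytime eA eC g.
Proof. by move=> E [p [h Hh r]]; exists p, h => // n x; rewrite E. Qed.

Lemma polytime_ext B (eB : encoder B) f g :
  (forall n x, g n x = f n x) -> polytime eA eB f -> polytime eA eB g.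
Proof. by move=> E; apply: polytime_recode => n x; rewrite E. Qed.

Lemma polytime_id : polytime eA eA (fun n x => x).
Proof.
by exists Id, (fun n x => tree_size (eA n x)) => [|n x]; [exact: poly_size|exact: runs_id].
Qed.

Lemma polytime_comp B C (eB : encoder B) (eC : encoder C) f g :
  polytime eA eB f -> polytime eB eC g -> polytime eA eC (fun n x => g n (f n x)).
Proof.
move=> Pf [q [h Hh rg]]; have [p [l Hl rf]] := Pf.
exists (Seq p q), (fun n x => (l n x + h n (f n x) + 1)) => [|n x].
  apply: poly_add (poly_const _ _); apply: poly_add Hl _.
  exact: poly_comp Hh (fun n x => leqnn _) (polytime_output Pf).
by rewrite addn1; apply: runs_seq (rf n x) (rg n (f n x)).
Qed.

Lemma polytime_const B (eB : encoder B) t f : (forall n x, eB n (f n x) = t) ->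
  polytime eA eB f.
Proof.
move=> E; apply: (@polytime_recode _ _ eTree _ (fun _ _ => t)) => //.
elim: t {E} => [|a [p [h Hh rp]] b [q [l Hl rq]]].
  exists Defs.Nil, (fun n x => tree_size (eA n x)) => [|n x]; [exact: poly_size|exact: runs_nil].
exists (Pair p q), (fun n x => h n x + l n x + 1) => [|n x].
  by apply: poly_add (poly_const _ _); apply: poly_add.
by rewrite addn1; apply: runs_pair (rp n x) (rq n x).
Qed.

Lemma polytime_pair B C (eB : encoder B) (eC : encoder C) f g :
  polytime eA eB f -> polytime eA eC g ->
  polytime eA (ePair eB eC) (fun n x => (f n x, g n x)).
Proof.
move=> [p [h Hh rp]] [q [l Hl rq]].
exists (Pair p q), (fun n x => h n x + l n x + 1) => [|n x].
  by apply: poly_add (poly_const _ _); apply: poly_add.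
by rewrite addn1; apply: runs_pair (rp n x) (rq n x).
Qed.

Lemma polytime_fst B C (eB : encoder B) (eC : encoder C) f :
  polytime eA (ePair eB eC) f -> polytime eA eB (fun n x => (f n x).1).
Proof.
move=> Pf; apply: (polytime_comp Pf (g := fun n z => z.1)).
exists Head, (fun n z => tree_size (ePair eB eC n z)) => [|n z]; [exact: poly_size|exact: runs_head].
Qed.

Lemma polytime_snd B C (eB : encoder B) (eC : encoder C) f :
  polytime eA (ePair eB eC) f -> polytime eA eC (fun n x => (f n x).2).
Proof.
move=> Pf; apply: (polytime_comp Pf (g := fun n z => z.2)).
exists Tail, (fun n z => tree_size (ePair eB eC n z)) => [|n z]; [exact: poly_size|exact: runs_tail].
Qed.

Lemma polytime_if B (eB : encoder B) b f g :
  polytime eA eBool b -> polytime eA eB f -> polytime eA eB g ->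
  polytime eA eB (fun n x => if b n x then f n x else g n x).
Proof.
move=> [r [h Hh rr]] [p [k Hk rp]] [q [l Hl rq]].
exists (If r p q), (fun n x => h n x + (k n x + l n x) + 1) => [|n x].
  by apply: poly_add (poly_const _ _); apply: poly_add Hh _; apply: poly_add.
rewrite addn1; apply: runs_if (rr n x) _; rewrite /eBool.
case: (b n x) => /=; first by apply: runs_le (rp n x); rewrite leq_addr.
by apply: runs_le (rq n x); rewrite leq_addl.
Qed.

Definition injective_encoder B (eB : encoder B) := forall n, injective (eB n).

Lemma polytime_eq (B : nat -> eqType) (eB : encoder (fun n => B n)) f g :
  injective_encoder eB -> polytime eA eB f -> polytime eA eB g ->
  polytime eA eBool (fun n x => f n x == g n x).
Proof.
move=> inj Pf Pg; apply: (polytime_comp (polytime_pair Pf Pg) (g := fun n z => z.1 == z.2)).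
exists Defs.Eq, (fun n z => tree_size (ePair eB eB n z)) => [|n z]; first exact: poly_size.
rewrite /eBool (_ : (z.1 == z.2) = tree_eq (eB n z.1) (eB n z.2)); first exact: runs_eq.
by apply/eqP/idP => [->|/tree_eqP/inj//]; apply/tree_eqP.
Qed.

Lemma polytime_nil B (eB : encoder B) : polytime eA (eSeq eB) (fun _ _ => [::]).
Proof. by apply: (@polytime_const _ _ Leaf). Qed.

Lemma polytime_cons B (eB : encoder B) f g : polytime eA eB f -> polytime eA (eSeq eB) g ->
  polytime eA (eSeq eB) (fun n x => f n x :: g n x).
Proof. by move=> Pf Pg; apply: polytime_recode (polytime_pair Pf Pg). Qed.

(** The code of a list is its own nonemptiness test, a nonempty list being a [Node]. The list is
    recomputed for its head and its tail, as the single variable must keep the input. *)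
Lemma polytime_seq_case B C (eB : encoder B) (eC : encoder C) s f0 f1 :
  polytime eA (eSeq eB) s -> polytime eA eC f0 ->
  polytime (ePair (ePair eA eB) (eSeq eB)) eC (fun n z => f1 n z.1.1 z.1.2 z.2) ->
  polytime eA eC (fun n x => if s n x is b :: t then f1 n x b t else f0 n x).
Proof.
move=> Ps [p [h Hh rp]] [q [l [k Hk] rq]]; have [r [m Hm rr]] := Ps.
pose W n x := tree_size (eA n x) + tree_size (eSeq eB n (s n x)) + 1.
have HW : poly_bounded eA W.
  by apply: poly_add (poly_const _ _); apply: poly_add (poly_size _) (polytime_output Ps).
pose K n x := 2 * m n x + 2 * W n x + k * W n x ^ k + 6.
exists (If r (Seq (Pair (Pair Id (Seq r Head)) (Seq r Tail)) q) p),
  (fun n x => m n x + (h n x + K n x) + 1) => [|n x].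
  by rewrite /K; poly_bound.
rewrite addn1; apply: runs_if (rr n x) _.
have := rr n x; have := Hk n; have := rq n; rewrite /K /W {K W HW Hm Hh Hk rq}.
case: (s n x) => [|b t] /= rq Hk rs; first by apply: runs_le (rp n x); rewrite leq_addr.
pose S := Node (eB n b) (tree_of_seq (eB n) t).
have r1 := runs_pair (runs_pair (runs_id (eA n x)) (runs_seq rs (runs_head _ _)))
                     (runs_seq rs (runs_tail _ _)).
apply: runs_le (runs_seq r1 (rq ((x, b), t))).
have := Hk ((x, b), t); rewrite /ePair /eSeq /=.
set w := (X in X ^ k); set w' := (X in _ + k * X ^ k).
have le : k * w ^ k <= k * w' ^ k by rewrite leq_mul2l leq_exp ?orbT // /w /w'; lia.
rewrite /w'; move: le; move: (k * w ^ k) (k * w' ^ k) => u v; lia.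
Qed.

(** The loop carries the input, the accumulator and the unread list, and [Tail] is its test. The
    cost K of the body is assumed only for accumulators of size at most M and elements of size at
    most L. *)
Lemma runs_loop B S (eB : encoder B) (eS : encoder S) q n (x : A n) (g : S n -> B n -> S n)
    (s : S n) l M L K :
  (forall s b, tree_size (eS n s) <= M -> tree_size (eB n b) <= L ->
     runs q (Node (Node (eA n x) (eS n s)) (eB n b)) (eS n (g s b)) K) ->
  (forall i, tree_size (eS n (foldl g s (take i l))) <= M) ->
  tree_size (eSeq eB n l) <= L ->
  runs (While Tail (Pair (Pair (Seq Head Head) (Seq (Pair Head (Seq Tail Head)) q))
                         (Seq Tail Tail)))
    (Node (Node (eA n x) (eS n s)) (eSeq eB n l))
    (Node (Node (eA n x) (eS n (foldl g s l))) Leaf)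
    ((size l).+1 * (10 * (tree_size (eA n x) + M + L + 2) + K + 10)).
Proof.
move=> rq; set W := tree_size _ + M + L + 2; elim: l s => [|b l IH] s HM HL /=.
  apply: runs_le (runs_while_stop _ (runs_tail _ _)).
  by have := HM 0; move: HL; rewrite /eSeq /= /W; lia.
have HM0 : tree_size (eS n s) <= M by have := HM 0.
have Hb : tree_size (eB n b) <= L by move: HL; rewrite /eSeq /=; lia.
set T := Node (Node _ _) _.
have hT : tree_size T <= W by move: HL HM0; rewrite /T /W /eSeq /=; lia.
have r1 : runs (Seq Head Head) T (eA n x) (2 * W).+1.
  apply: runs_le (runs_seq (runs_head _ _) (runs_head _ _)).
  by move: hT; rewrite /T /=; lia.
have r2 : runs (Seq Tail Head) T (eB n b) (2 * W).+1.
  apply: runs_le (runs_seq (runs_tail _ _) (runs_head _ _)).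
  by move: hT; rewrite /T /=; lia.
have r3 : runs (Seq Tail Tail) T (eSeq eB n l) (2 * W).+1.
  apply: runs_le (runs_seq (runs_tail _ _) (runs_tail _ _)).
  by move: hT; rewrite /T /=; lia.
have r4 : runs Head T (Node (eA n x) (eS n s)) W.
  by apply: runs_le (runs_head _ _); move: hT; rewrite /T.
have r5 : runs Tail T (Node (eB n b) (eSeq eB n l)) W.
  by apply: runs_le (runs_tail _ _); move: hT; rewrite /T.
have body := runs_pair (runs_pair r1 (runs_seq (runs_pair r4 r2) (rq s b HM0 Hb))) r3.
have HL' : tree_size (eSeq eB n l) <= L by move: HL; rewrite /eSeq /=; lia.
have rest := IH (g s b) (fun i => HM i.+1) HL'.
apply: runs_le (runs_while_step r5 body rest).
by rewrite [in X in _ <= X]mulSn; lia.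
Qed.

(** A polynomial-time step alone is not enough, as its iteration may grow the accumulator
    exponentially; hence the bound on all intermediate values. *)
Lemma polytime_foldl B S (eB : encoder B) (eS : encoder S) l s0
    (g : forall n, A n -> S n -> B n -> S n) :
  polytime eA (eSeq eB) l -> polytime eA eS s0 ->
  polytime (ePair (ePair eA eS) eB) eS (fun n z => g n z.1.1 z.1.2 z.2) ->
  (exists2 M, poly_bounded eA M & forall n x i,
     tree_size (eS n (foldl (g n x) (s0 n x) (take i (l n x)))) <= M n x) ->
  polytime eA eS (fun n x => foldl (g n x) (s0 n x) (l n x)).
Proof.
move=> Pl Ps [q [h [k Hk] rq]] [M HM bM].
have [pl [bl Hbl rl]] := Pl; have [ps [bs Hbs rs]] := Ps.
pose L n x := tree_size (eSeq eB n (l n x)).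
have HL : poly_bounded eA L := polytime_output Pl.
pose W n x := tree_size (eA n x) + M n x + L n x + 2.
have HW : poly_bounded eA W.
  by rewrite /W; poly_bound.
pose C n x := (L n x).+1 * (10 * W n x + k * W n x ^ k + 10).
exists (Seq (Seq (Pair (Pair Id ps) pl)
   (While Tail (Pair (Pair (Seq Head Head) (Seq (Pair Head (Seq Tail Head)) q))
                         (Seq Tail Tail)))) (Seq Head Tail)),
  (fun n x => bs n x + bl n x + C n x + 4 * W n x + 10) => [|n x].
  by rewrite /C; poly_bound.
have r1 := runs_pair (runs_pair (runs_id (eA n x)) (rs n x)) (rl n x).
have r2 : runs _ _ _ _ := @runs_loop _ _ eB eS q n x (g n x) (s0 n x) (l n x) (M n x) (L n x)
  (k * W n x ^ k) _ (bM n x) (leqnn _).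
have sz := bM n x (size (l n x)); rewrite take_size in sz.
have r3 := runs_seq (runs_head (Node (eA n x) (eS n (foldl (g n x) (s0 n x) (l n x)))) Leaf)
                    (runs_tail _ _).
apply: runs_le (runs_seq (runs_seq r1 (r2 _)) r3); last first.
  move=> s b hs hb; apply: runs_le (rq n ((x, s), b)).
  apply: leq_trans (Hk _ _) _; rewrite leq_mul2l leq_exp ?orbT //.
  by rewrite /ePair /= /W; lia.
rewrite /C -/(W n x).
have szl : size (l n x) <= L n x.
  by rewrite /L /eSeq; elim: (l n x) => //= b t IH; lia.
have : (size (l n x)).+1 * (10 * W n x + k * W n x ^ k + 10) <=
       (L n x).+1 * (10 * W n x + k * W n x ^ k + 10) by rewrite leq_mul2r ltnS szl orbT.
move: (_ * (10 * _ + _ + _)) (_ * (10 * _ + _ + _)) => u v.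
by move: sz; rewrite /W /=; lia.
Qed.

(** An increment independent of the accumulator adds up to a polynomial over the list. It is
    required only for elements no larger than the list, whose size the input bounds. *)
Lemma polytime_foldl_add B S (eB : encoder B) (eS : encoder S) l s0
    (g : forall n, A n -> S n -> B n -> S n) :
  polytime eA (eSeq eB) l -> polytime eA eS s0 ->
  polytime (ePair (ePair eA eS) eB) eS (fun n z => g n z.1.1 z.1.2 z.2) ->
  (exists2 c, poly_bounded eA c & forall n x s b,
     tree_size (eB n b) <= tree_size (eSeq eB n (l n x)) ->
     tree_size (eS n (g n x s b)) <= tree_size (eS n s) + c n x) ->
  polytime eA eS (fun n x => foldl (g n x) (s0 n x) (l n x)).
Proof.
move=> Pl Ps Pg [c Hc bc]; apply: (polytime_foldl Pl Ps Pg).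
exists (fun n x => tree_size (eS n (s0 n x)) + tree_size (eSeq eB n (l n x)) * c n x).
  by apply: poly_add (polytime_output Ps) _; apply: poly_mul (polytime_output Pl) Hc.
move=> n x i; set L := tree_size (eSeq _ _ _).
have szl : size (l n x) <= L by rewrite /L /eSeq; elim: (l n x) => //= b t IH; lia.
apply: (@leq_trans (tree_size (eS n (s0 n x)) + size (l n x) * c n x)); last first.
  by rewrite leq_add2l leq_mul2r szl orbT.
move: {szl} L (leqnn L : tree_size (eSeq eB n (l n x)) <= L) (bc n x : forall s b, _ <= L -> _).
move=> L; elim: (l n x) (s0 n x) i => [|b t IH] s i hL bc' /=; first by rewrite addn0.
case: i => [|i] /=; first by rewrite leq_addr.
apply: leq_trans (IH _ i _ bc') _; first by move: hL; rewrite /eSeq /=; lia.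
have /(bc' s) : tree_size (eB n b) <= L by move: hL; rewrite /eSeq /=; lia.
by rewrite mulSn; lia.
Qed.

End Closure.

Lemma tree_size_seq T (f : T -> tree) s :
  tree_size (tree_of_seq f s) = (\sum_(b <- s) (tree_size (f b)).+1).+1.
Proof. by elim: s => [|b s IH] /=; rewrite ?big_nil // big_cons IH; lia. Qed.

Lemma leq_sum_seq (T : eqType) (s : seq T) (F : T -> nat) c :
  {in s, forall b, F b <= c} -> \sum_(b <- s) F b <= size s * c.
Proof.
elim: s => [|b s IH] H; first by rewrite big_nil.
rewrite big_cons mulSn leq_add //; first by rewrite H // mem_head.
by apply: IH => k ks; rewrite H // inE ks orbT.
Qed.

Ltac pt_proj := repeat first [ exact: polytime_id | apply: polytime_fst | apply: polytime_snd ].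

(** * Booleans and lists *)

Section BasicLists.
Variables (A : nat -> Type) (eA : encoder A).
Arguments eA : clear implicits.

Lemma polytime_true : polytime eA eBool (fun _ _ => true).
Proof. exact: (@polytime_const _ _ _ _ (Node Leaf Leaf)). Qed.

Lemma polytime_false : polytime eA eBool (fun _ _ => false).
Proof. exact: (@polytime_const _ _ _ _ Leaf). Qed.

Lemma polytime_negb b : polytime eA eBool b -> polytime eA eBool (fun n x => ~~ b n x).
Proof. by move=> Pb; apply: polytime_if Pb polytime_false polytime_true. Qed.

Lemma polytime_andb b c : polytime eA eBool b -> polytime eA eBool c ->
  polytime eA eBool (fun n x => b n x && c n x).
Proof. by move=> Pb Pc; apply: polytime_if Pb Pc polytime_false. Qed.

Lemma polytime_orb b c : polytime eA eBool b -> polytime eA eBool c ->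
  polytime eA eBool (fun n x => b n x || c n x).
Proof. by move=> Pb Pc; apply: polytime_if Pb polytime_true Pc. Qed.

Lemma polytime_implb b c : polytime eA eBool b -> polytime eA eBool c ->
  polytime eA eBool (fun n x => b n x ==> c n x).
Proof. by move=> Pb Pc; apply: polytime_if Pb Pc polytime_true. Qed.

Lemma output_bound B C (eB : encoder B) (eC : encoder C) l (f : forall n, A n -> B n -> C n) :
  polytime eA (eSeq eB) l -> polytime (ePair eA eB) eC (fun n z => f n z.1 z.2) ->
  exists2 c, poly_bounded eA c & forall n x b,
    tree_size (eB n b) <= tree_size (eSeq eB n (l n x)) -> tree_size (eC n (f n x b)) <= c n x.
Proof.
move=> Pl /polytime_output[k Hk]; have Hl := polytime_output Pl.
exists (fun n x => k * (tree_size (eA n x) + tree_size (eSeq eB n (l n x)) + 1) ^ k).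
  by poly_bound.
move=> n x b hb; apply: leq_trans (Hk n (x, b)) _.
by rewrite leq_mul2l leq_exp ?orbT // /ePair /=; lia.
Qed.

Lemma polytime_rev B (eB : encoder B) s : polytime eA (eSeq eB) s -> polytime eA (eSeq eB) (fun n x => rev (s n x)).
Proof.
move=> Ps; apply: (@polytime_ext _ _ _ _ (fun n x => foldl (fun u b => b :: u) [::] (s n x))).
  by move=> n x; rewrite /rev; elim: (s n x) [::] => //= b t IH u; rewrite IH.
apply: (@polytime_foldl_add _ _ _ _ _ _ _ _ (fun n x u b => b :: u) Ps (polytime_nil eA eB)).
  apply: polytime_cons; first by apply: polytime_snd; exact: polytime_id.
  by apply: polytime_snd; apply: polytime_fst; exact: polytime_id.
exists (fun n x => (tree_size (eSeq eB n (s n x))).+1).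
  by have := polytime_output Ps => Hs; poly_bound.
by move=> n x u b; rewrite /eSeq /=; lia.
Qed.

Lemma polytime_foldr B S (eB : encoder B) (eS : encoder S) l s0
    (g : forall n, A n -> B n -> S n -> S n) :
  polytime eA (eSeq eB) l -> polytime eA eS s0 ->
  polytime (ePair (ePair eA eB) eS) eS (fun n z => g n z.1.1 z.1.2 z.2) ->
  (exists2 c, poly_bounded eA c & forall n x b s,
     tree_size (eB n b) <= tree_size (eSeq eB n (l n x)) ->
     tree_size (eS n (g n x b s)) <= tree_size (eS n s) + c n x) ->
  polytime eA eS (fun n x => foldr (g n x) (s0 n x) (l n x)).
Proof.
move=> Pl Ps Pg [c Hc bc].
apply: (@polytime_ext _ _ _ _ (fun n x => foldl (fun s b => g n x b s) (s0 n x) (rev (l n x)))).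
  by move=> n x; rewrite foldl_rev.
apply: (@polytime_foldl_add _ _ _ _ _ _ _ _ (fun n x s b => g n x b s) (polytime_rev Pl) Ps).
  apply: (polytime_comp (f := fun n z => ((z.1.1, z.2), z.1.2)) _ Pg).
  by apply: polytime_pair; [apply: polytime_pair|]; pt_proj.
exists c => // n x s b; rewrite /eSeq tree_size_seq big_rev -tree_size_seq; exact: bc.
Qed.

Lemma polytime_fst_arg B S C (eB : encoder B) (eS : encoder S) (eC : encoder C)
    (f : forall n, A n -> B n -> C n) :
  polytime (ePair eA eB) eC (fun n z => f n z.1 z.2) ->
  polytime (ePair (ePair eA eB) eS) eC (fun n z => f n z.1.1 z.1.2).
Proof. by move=> Pf; apply: (polytime_comp (f := fun n z => z.1) _ Pf); pt_proj. Qed.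

Lemma polytime_cat B (eB : encoder B) s t : polytime eA (eSeq eB) s -> polytime eA (eSeq eB) t ->
  polytime eA (eSeq eB) (fun n x => s n x ++ t n x).
Proof.
move=> Ps Pt; apply: (@polytime_ext _ _ _ _ (fun n x => foldr cons (t n x) (s n x))).
  by move=> n x; elim: (s n x) => //= b u ->.
apply: (@polytime_foldr _ _ _ _ _ _ (fun n x b u => b :: u) Ps Pt).
  by apply: polytime_cons; pt_proj.
exists (fun n x => (tree_size (eSeq eB n (s n x))).+1).
  by have := polytime_output Ps => Hs; poly_bound.
by move=> n x u b; rewrite /eSeq /=; lia.
Qed.

Lemma polytime_rcons B (eB : encoder B) s b : polytime eA (eSeq eB) s -> polytime eA eB b ->
  polytime eA (eSeq eB) (fun n x => rcons (s n x) (b n x)).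
Proof.
move=> Ps Pb; apply: (@polytime_ext _ _ _ _ (fun n x => s n x ++ [:: b n x])).
  by move=> n x; rewrite cats1.
by apply: polytime_cat Ps _; apply: polytime_cons Pb _; exact: polytime_nil.
Qed.

Lemma polytime_map B C (eB : encoder B) (eC : encoder C) s (f : forall n, A n -> B n -> C n) :
  polytime eA (eSeq eB) s -> polytime (ePair eA eB) eC (fun n z => f n z.1 z.2) ->
  polytime eA (eSeq eC) (fun n x => map (f n x) (s n x)).
Proof.
move=> Ps Pf; have [c Hc bc] := output_bound Ps Pf.
apply: (@polytime_ext _ _ _ _ (fun n x => foldr (fun b u => f n x b :: u) [::] (s n x))).
  by move=> n x; elim: (s n x) => //= b u ->.
apply: (@polytime_foldr _ _ _ _ _ _ (fun n x b u => f n x b :: u) Ps (polytime_nil eA eC)).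
  by apply: polytime_cons; [exact: polytime_fst_arg|pt_proj].
exists (fun n x => (c n x).+1); first by poly_bound.
by move=> n x b u /bc; rewrite /eSeq /=; lia.
Qed.

Lemma polytime_filter B (eB : encoder B) s (t : forall n, A n -> B n -> bool) :
  polytime eA (eSeq eB) s -> polytime (ePair eA eB) eBool (fun n z => t n z.1 z.2) ->
  polytime eA (eSeq eB) (fun n x => filter (t n x) (s n x)).
Proof.
move=> Ps Pt; have Hs := polytime_output Ps.
apply: (@polytime_ext _ _ _ _
  (fun n x => foldr (fun b u => if t n x b then b :: u else u) [::] (s n x))).
  by move=> n x; elim: (s n x) => //= b u ->.
apply: (@polytime_foldr _ _ _ _ _ _ (fun n x b u => if t n x b then b :: u else u)
         Ps (polytime_nil eA eB)).
  by apply: polytime_if; [exact: polytime_fst_arg|apply: polytime_cons|]; pt_proj.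
exists (fun n x => (tree_size (eSeq eB n (s n x))).+1); first by poly_bound.
by move=> n x b u; rewrite /eSeq; case: ifP => _ /=; lia.
Qed.

End BasicLists.

(** * Unary numbers and further folds *)

Definition eNat : encoder (fun=> nat) := fun _ => tree_of_nat.

Definition eUnit : encoder (fun=> unit) := fun _ _ => Leaf.

Arguments eNat : clear implicits.
Arguments eUnit : clear implicits.

(** Numerals are lists of units, so arithmetic reduces to list programs. *)
Lemma tree_of_natE m n : tree_of_nat m = eSeq eUnit n (nseq m tt).
Proof. by elim: m => //= m ->. Qed.

Lemma tree_size_nat m : tree_size (tree_of_nat m) = (2 * m).+1.
Proof. by elim: m => //= m ->; lia. Qed.

Section Successor.
Variables (A : nat -> Type) (eA : encoder A).

Lemma polytime_succ f : polytime eA eNat f -> polytime eA eNat (fun n x => (f n x).+1).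
Proof.
move=> Pf; have Pl : polytime eA eTree (fun _ _ => Leaf) by exact: (@polytime_const _ _ _ _ Leaf).
exact: polytime_recode (polytime_pair Pl Pf).
Qed.

Lemma polytime_zero : polytime eA eNat (fun _ _ => 0).
Proof. exact: (@polytime_const _ _ _ _ Leaf). Qed.

End Successor.

Section Folds.
Variables (A : nat -> Type) (eA : encoder A).
Arguments eA : clear implicits.

Lemma polytime_flatten B (eB : encoder B) s : polytime eA (eSeq (eSeq eB)) s ->
  polytime eA (eSeq eB) (fun n x => flatten (s n x)).
Proof.
move=> Ps; have Hs := polytime_output Ps.
apply: (@polytime_foldr _ _ _ _ _ _ _ _ (fun n x b u => b ++ u) Ps (polytime_nil eA eB)).
  by apply: polytime_cat; pt_proj.
exists (fun n x => tree_size (eSeq (eSeq eB) n (s n x))) => // n x b u.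
by rewrite /eSeq !tree_size_seq big_cat /=; lia.
Qed.

Lemma polytime_has B (eB : encoder B) s (t : forall n, A n -> B n -> bool) :
  polytime eA (eSeq eB) s -> polytime (ePair eA eB) eBool (fun n z => t n z.1 z.2) ->
  polytime eA eBool (fun n x => has (t n x) (s n x)).
Proof.
move=> Ps Pt.
apply: (@polytime_ext _ _ _ _ (fun n x => foldr (fun b u => t n x b || u) false (s n x))).
  by move=> n x; elim: (s n x) => //= b u ->.
apply: (@polytime_foldr _ _ _ _ _ _ _ _ (fun n x b u => t n x b || u) Ps (polytime_false eA)).
  by apply: polytime_orb; [exact: polytime_fst_arg|pt_proj].
exists (fun n x => 3); first by poly_bound.
by move=> n x b u _; rewrite /eBool; case: (_ || _) => /=; lia.
Qed.

Lemma polytime_all B (eB : encoder B) s (t : forall n, A n -> B n -> bool) :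
  polytime eA (eSeq eB) s -> polytime (ePair eA eB) eBool (fun n z => t n z.1 z.2) ->
  polytime eA eBool (fun n x => all (t n x) (s n x)).
Proof.
move=> Ps Pt.
apply: (@polytime_ext _ _ _ _ (fun n x => ~~ has (fun b => ~~ t n x b) (s n x))).
  by move=> n x; rewrite -all_predC; apply: eq_all => b /=; rewrite negbK.
apply: polytime_negb; apply: (polytime_has (t := fun n x b => ~~ t n x b) Ps).
exact: polytime_negb.
Qed.

Lemma polytime_find B (eB : encoder B) s (t : forall n, A n -> B n -> bool) :
  polytime eA (eSeq eB) s -> polytime (ePair eA eB) eBool (fun n z => t n z.1 z.2) ->
  polytime eA eNat (fun n x => find (t n x) (s n x)).
Proof.
move=> Ps Pt.
apply: (@polytime_ext _ _ _ _
   (fun n x => foldr (fun b m => if t n x b then 0 else m.+1) 0 (s n x))).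
  by move=> n x; elim: (s n x) => //= b u ->.
apply: (@polytime_foldr _ _ _ _ _ _ _ _ (fun n x b m => if t n x b then 0 else m.+1) Ps
          (polytime_zero eA)).
  apply: polytime_if; [exact: polytime_fst_arg| |].
    exact: (@polytime_const _ _ _ _ Leaf).
  by apply: polytime_succ; pt_proj.
exists (fun n x => 2); first by poly_bound.
by move=> n x b u _; rewrite /eNat !tree_size_nat; case: ifP; lia.
Qed.

Lemma polytime_units m : polytime eA eNat m <-> polytime eA (eSeq eUnit) (fun n x => nseq (m n x) tt).
Proof. by split; apply: polytime_recode => n x; rewrite /eNat (tree_of_natE _ n). Qed.

Lemma polytime_iter S (eS : encoder S) m s0 (f : forall n, A n -> S n -> S n) :
  polytime eA eNat m -> polytime eA eS s0 ->
  polytime (ePair eA eS) eS (fun n z => f n z.1 z.2) ->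
  (exists2 c, poly_bounded eA c & forall n x s,
     tree_size (eS n (f n x s)) <= tree_size (eS n s) + c n x) ->
  polytime eA eS (fun n x => iter (m n x) (f n x) (s0 n x)).
Proof.
move=> /polytime_units Pm Ps Pf [c Hc bc].
apply: (@polytime_ext _ _ _ _
   (fun n x => foldr (fun _ s => f n x s) (s0 n x) (nseq (m n x) tt))).
  by move=> n x; elim: (m n x) => //= k ->.
apply: (@polytime_foldr _ _ _ _ _ _ _ _ (fun n x _ s => f n x s) Pm Ps).
  apply: (polytime_comp (f := fun n z => (z.1.1, z.2)) _ Pf).
  by apply: polytime_pair; pt_proj.
by exists c => // n x b s _.
Qed.

Lemma polytime_pred f : polytime eA eNat f -> polytime eA eNat (fun n x => (f n x).-1).
Proof.
move=> /polytime_units Pf; apply/polytime_units.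
apply: (@polytime_ext _ _ _ _ (fun n x => if nseq (f n x) tt is _ :: t then t else [::])).
  by move=> n x; case: (f n x).
by apply: polytime_seq_case Pf (polytime_nil _ _) _; pt_proj.
Qed.

Lemma polytime_eq0 f : polytime eA eNat f -> polytime eA eBool (fun n x => f n x == 0).
Proof.
move=> /polytime_units Pf.
apply: (@polytime_ext _ _ _ _ (fun n x => if nseq (f n x) tt is _ :: t then false else true)).
  by move=> n x; case: (f n x).
by apply: polytime_seq_case Pf (polytime_true _) _; exact: polytime_false.
Qed.

Lemma polytime_size B (eB : encoder B) s : polytime eA (eSeq eB) s ->
  polytime eA eNat (fun n x => size (s n x)).
Proof.
move=> Ps; apply/polytime_units.
apply: (@polytime_ext _ _ _ _ (fun n x => map (fun=> tt) (s n x))).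
  by move=> n x; elim: (s n x) => //= b t ->.
apply: polytime_map Ps _; exact: (@polytime_const _ _ _ _ Leaf).
Qed.

Lemma polytime_addn f g : polytime eA eNat f -> polytime eA eNat g ->
  polytime eA eNat (fun n x => f n x + g n x).
Proof.
move=> /polytime_units Pf /polytime_units Pg; apply/polytime_units.
apply: polytime_ext (polytime_cat Pf Pg) => n x; exact: nseqD.
Qed.

End Folds.

Section Arithmetic.
Variables (A : nat -> Type) (eA : encoder A).
Arguments eA : clear implicits.

Lemma polytime_subn f g : polytime eA eNat f -> polytime eA eNat g ->
  polytime eA eNat (fun n x => f n x - g n x).
Proof.
move=> Pf Pg; apply: (@polytime_ext _ _ _ _ (fun n x => iter (g n x) predn (f n x))).
  by move=> n x; rewrite iter_predn.
apply: (polytime_iter (f := fun n x => predn) Pg Pf); first by apply: polytime_pred; pt_proj.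
by exists (fun _ _ => 0) => [|n x s]; [exact: poly_const|rewrite /eNat !tree_size_nat; lia].
Qed.

Lemma polytime_leq f g : polytime eA eNat f -> polytime eA eNat g ->
  polytime eA eBool (fun n x => f n x <= g n x).
Proof. by move=> Pf Pg; apply: polytime_eq0; exact: polytime_subn. Qed.

Lemma polytime_nseq B (eB : encoder B) m b : polytime eA eNat m -> polytime eA eB b ->
  polytime eA (eSeq eB) (fun n x => nseq (m n x) (b n x)).
Proof.
move=> /polytime_units Pm Pb.
apply: (@polytime_ext _ _ _ _ (fun n x => map (fun=> b n x) (nseq (m n x) tt))).
  by move=> n x; rewrite map_nseq.
apply: polytime_map Pm _.
by apply: (polytime_comp (f := fun n z => z.1) _ Pb); pt_proj.
Qed.

Lemma polytime_take B (eB : encoder B) m s : polytime eA eNat m -> polytime eA (eSeq eB) s ->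
  polytime eA (eSeq eB) (fun n x => take (m n x) (s n x)).
Proof.
move=> Pm Ps; have Hs := polytime_output Ps.
pose g (n : nat) (x : A n) (st : nat * seq (B n)) (b : B n) :=
  if st.1 == 0 then st else (st.1.-1, b :: st.2).
apply: (@polytime_ext _ _ _ _ (fun n x => rev (foldl (g n x) (m n x, [::]) (s n x)).2)).
  move=> n x; suff E k u t : rev (foldl (g n x) (k, u) t).2 = rev u ++ take k t by rewrite E.
  elim: t k u => [|b t IH] k u /=; first by rewrite cats0.
  by case: k => [|k]; rewrite [g _ _ _ _]/= IH ?take0 ?rev_cons ?cat_rcons.
apply: polytime_rev; apply: polytime_snd.
apply: (@polytime_foldl_add _ _ _ _ _ _ _ _ g Ps (polytime_pair Pm (polytime_nil _ _))).
  apply: polytime_if; [by apply: polytime_eq0; pt_proj|pt_proj|].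
  by apply: polytime_pair; [apply: polytime_pred|apply: polytime_cons]; pt_proj.
exists (fun n x => (tree_size (eSeq eB n (s n x))).+1); first by poly_bound.
move=> n x [k u] b hb; rewrite /g /ePair /eNat /eSeq /=.
by case: eqP => _ /=; rewrite ?tree_size_nat; move: hb; rewrite /eSeq; lia.
Qed.

Lemma polytime_iota m : polytime eA eNat m -> polytime eA (eSeq eNat) (fun n x => iota 0 (m n x)).
Proof.
move=> Pm; have Hm := polytime_output Pm; have /polytime_units Pu := Pm.
pose g (n : nat) (x : A n) (st : nat * seq nat) (b : unit) := (st.1.-1, st.1.-1 :: st.2).
have E n x i : i <= m n x -> foldl (g n x) (m n x, [::]) (nseq i tt) = (m n x - i, iota (m n x - i) i).
  elim: i => [|i IH] le; first by rewrite subn0.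
  rewrite -addn1 nseqD foldl_cat IH ?(ltnW le) //= /g /= addn1 subnS; congr pair.
  by rewrite -[in iota _ _.+1]/(iota _ (1 + i)) /=; congr (_ :: iota _ _); lia.
apply: (@polytime_ext _ _ _ _ (fun n x => (foldl (g n x) (m n x, [::]) (nseq (m n x) tt)).2)).
  by move=> n x; rewrite E // subnn.
apply: polytime_snd.
apply: (@polytime_foldl _ _ _ _ _ _ _ _ g Pu (polytime_pair Pm (polytime_nil _ _))).
  by apply: polytime_pair; [|apply: polytime_cons]; try apply: polytime_pred; pt_proj.
exists (fun n x => tree_size (eNat n (m n x)) + tree_size (eNat n (m n x)) * (tree_size (eNat n (m n x))).+1 + 2).
  by poly_bound.
move=> n x i; wlog le : i / i <= m n x => [H|].
  case: (leqP i (m n x)) => [|lt]; first exact: H.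
  have := H (m n x) (leqnn _); rewrite !take_oversize ?size_nseq //; exact: ltnW.
rewrite take_nseq // E // /ePair /eNat /eSeq /= tree_size_seq !tree_size_nat.
have : \sum_(b <- iota (m n x - i) i) (tree_size (tree_of_nat b)).+1 <= i * (2 * m n x).+2.
  rewrite -[i in i * _](size_iota (m n x - i) i); apply: leq_sum_seq => b.
  by rewrite mem_iota tree_size_nat; lia.
have : i * (2 * m n x).+2 <= (2 * m n x).+1 * (2 * m n x).+2 by rewrite leq_mul2r; lia.
move: (_ * (2 * _).+2) (_ * (2 * _).+2) => u v; lia.
Qed.

End Arithmetic.

(** * Codes of formulas, clauses and trails *)

Definition eOrd : encoder (fun n => 'I_n) := fun n i => tree_of_nat i.
Definition eLit : encoder (fun n => lit n) := ePair eOrd eBool.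
Definition eVars : encoder (fun n => {set 'I_n}) := fun n V => eSeq eOrd n (enum V).
Definition eClause : encoder (fun n => clause n) := fun n C => eSeq eLit n (enum C).
Definition eBlock : encoder (fun n => block n) := ePair eBool eVars.
Definition eQcnf : encoder qcnf := tree_of_qcnf.
Definition eEntry : encoder entry := tree_of_entry.
Definition eRound : encoder round := tree_of_round.
Arguments eOrd : clear implicits.
Arguments eLit : clear implicits.
Arguments eVars : clear implicits.
Arguments eClause : clear implicits.
Arguments eBlock : clear implicits.
Arguments eQcnf : clear implicits.
Arguments eEntry : clear implicits.
Arguments eRound : clear implicits.

Lemma tree_of_nat_inj : injective tree_of_nat.
Proof. by elim=> [|i IH] [|j] //= [/IH->]. Qed.

Lemma eOrd_inj : injective_encoder eOrd.
Proof. by move=> n i j /tree_of_nat_inj/val_inj. Qed.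

Lemma eLit_inj : injective_encoder eLit.
Proof. by move=> n [x b] [y c] [/eOrd_inj-> /=]; case: b c => -[]. Qed.

(** Sets of literals are computed by running through all literals, so n must be recoverable from the
    input. *)
Definition has_dim A (eA : encoder A) := polytime eA eNat (fun n _ => n).

Lemma dim_fst A B (eA : encoder A) (eB : encoder B) : has_dim eA -> has_dim (ePair eA eB).
Proof.
move=> H; apply: (polytime_comp (f := fun n z => z.1) _ H); exact: polytime_fst (polytime_id _).
Qed.

Lemma dim_snd A B (eA : encoder A) (eB : encoder B) : has_dim eB -> has_dim (ePair eA eB).
Proof.
move=> H; apply: (polytime_comp (f := fun n z => z.2) _ H); exact: polytime_snd (polytime_id _).
Qed.

Lemma dim_qcnf : has_dim eQcnf.
Proof.
exists Head, (fun n F => tree_size (eQcnf n F)) => [|n F]; first exact: poly_size.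
exact: runs_head.
Qed.

Ltac pt_dim := first [ assumption | exact: dim_qcnf
  | apply: dim_fst; pt_dim | apply: dim_snd; pt_dim ].

(** Under a binder, a function of the outer input is a projection composed with a hypothesis. *)
Ltac pt_hyp := match goal with
  | H : polytime _ _ _ |- polytime _ _ _ => apply: (polytime_comp _ H) end.

Ltac pt_leaf := first [ eassumption | exact: polytime_id | pt_hyp ].

Ltac pt_base := lazymatch goal with
  | |- has_dim _ => pt_dim
  | |- injective_encoder _ => first [ exact: eLit_inj | exact: eOrd_inj ]
  | |- polytime _ _ (fun n x => n) => pt_dim
  | |- polytime _ _ (fun n x => true) => exact: polytime_true
  | |- polytime _ _ (fun n x => false) => exact: polytime_false
  | |- polytime _ _ (fun n x => 0) => exact: polytime_zero
  | |- polytime _ _ (fun n x => nil) => exact: polytime_nil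
  | |- polytime _ _ (fun n x => fst _) => apply: polytime_fst
  | |- polytime _ _ (fun n x => snd _) => apply: polytime_snd
  | |- polytime _ _ (fun n x => (_, _)) => apply: polytime_pair
  | |- polytime _ _ (fun n x => ~~ _) => apply: polytime_negb
  | |- polytime _ _ (fun n x => _ && _) => apply: polytime_andb
  | |- polytime _ _ (fun n x => _ || _) => apply: polytime_orb
  | |- polytime _ _ (fun n x => _ ==> _) => apply: polytime_implb
  | |- polytime _ _ (fun n x => _ :: _) => apply: polytime_cons
  | |- polytime _ _ (fun n x => _ ++ _) => apply: polytime_cat
  | |- polytime _ _ (fun n x => rcons _ _) => apply: polytime_rcons
  | |- polytime _ _ (fun n x => rev _) => apply: polytime_rev
  | |- polytime _ _ (fun n x => map _ _) => apply: polytime_map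
  | |- polytime _ _ (fun n x => filter _ _) => apply: polytime_filter
  | |- polytime _ _ (fun n x => flatten _) => apply: polytime_flatten
  | |- polytime _ _ (fun n x => has _ _) => apply: polytime_has
  | |- polytime _ _ (fun n x => all _ _) => apply: polytime_all
  | |- polytime _ _ (fun n x => _.+1) => apply: polytime_succ
  | |- polytime _ _ (fun n x => _ <= _) => apply: polytime_leq
  | |- polytime _ _ (fun n x => _ + _) => apply: polytime_addn
  | |- polytime _ _ (fun n x => size _) => apply: polytime_size
  | |- polytime _ _ (fun n x => nseq _ _) => apply: polytime_nseq
  | |- polytime _ _ (fun n x => take _ _) => apply: polytime_take
  | |- polytime _ _ (fun n x => iota 0 _) => apply: polytime_iota
  | |- polytime _ _ (fun n x => find _ _) => apply: polytime_find
  | |- polytime _ _ (fun n x => eq_op _ _) => apply: polytime_eq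
  | |- polytime _ _ (fun n x => if _ then _ else _) => apply: polytime_if
  | |- _ => pt_leaf
  end.

Section Data.
Variables (A : nat -> Type) (eA : encoder A).
Arguments eA : clear implicits.

Lemma polytime_in_lits l (s : forall n, A n -> seq (lit n)) :
  polytime eA eLit l -> polytime eA (eSeq eLit) s ->
  polytime eA eBool (fun n x => l n x \in s n x).
Proof.
move=> Pl Ps; apply: (@polytime_ext _ _ _ _ (fun n x => has (fun k => k == l n x) (s n x))).
  by move=> n x; rewrite -has_pred1.
by do !pt_base.
Qed.

Lemma polytime_in_vars i (V : forall n, A n -> {set 'I_n}) :
  polytime eA eOrd i -> polytime eA eVars V ->
  polytime eA eBool (fun n x => i n x \in V n x).
Proof.
move=> Pi PV; apply: (@polytime_ext _ _ _ _ (fun n x => has (fun k => k == i n x) (enum (V n x)))).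
  by move=> n x; rewrite -mem_enum -has_pred1.
have {}PV : polytime eA (eSeq eOrd) (fun n x => enum (V n x)) by [].
by do !pt_base.
Qed.

Lemma polytime_enum (C : forall n, A n -> clause n) :
  polytime eA eClause C -> polytime eA (eSeq eLit) (fun n x => enum (C n x)).
Proof. by []. Qed.

Lemma polytime_in_clause l (C : forall n, A n -> clause n) :
  polytime eA eLit l -> polytime eA eClause C ->
  polytime eA eBool (fun n x => l n x \in C n x).
Proof.
move=> Pl PC; apply: (@polytime_ext _ _ _ _ (fun n x => l n x \in enum (C n x))).
  by move=> n x; rewrite mem_enum.
exact: polytime_in_lits.
Qed.

Lemma polytime_neg (l : forall n, A n -> lit n) :
  polytime eA eLit l -> polytime eA eLit (fun n x => neg (l n x)).
Proof. by move=> Pl; rewrite /neg; do !pt_base. Qed.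

Lemma polytime_blocks F : polytime eA eQcnf F ->
  polytime eA (eSeq eBlock) (fun n x => blocks (F n x)).
Proof.
move=> PF; have P' : polytime eA (ePair eNat (ePair (eSeq eBlock) (eSeq eClause)))
    (fun n x => (n, (blocks (F n x), matrix (F n x)))) by exact: polytime_recode PF.
exact: polytime_fst (polytime_snd P').
Qed.

Lemma polytime_matrix F : polytime eA eQcnf F ->
  polytime eA (eSeq eClause) (fun n x => matrix (F n x)).
Proof.
move=> PF; have P' : polytime eA (ePair eNat (ePair (eSeq eBlock) (eSeq eClause)))
    (fun n x => (n, (blocks (F n x), matrix (F n x)))) by exact: polytime_recode PF.
exact: polytime_snd (polytime_snd P').
Qed.

Lemma polytime_learn F (C : forall n, A n -> clause n) :
  polytime eA eQcnf F -> polytime eA eClause C ->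
  polytime eA eQcnf (fun n x => learn (F n x) (C n x)).
Proof.
move=> PF PC; have P' : polytime eA (ePair eNat (ePair (eSeq eBlock) (eSeq eClause)))
    (fun n x => (n, (blocks (F n x), rcons (matrix (F n x)) (C n x)))).
  apply: polytime_pair; first exact: polytime_comp PF dim_qcnf.
  by apply: polytime_pair; [exact: polytime_blocks|apply: polytime_rcons PC; exact: polytime_matrix].
exact: polytime_recode P'.
Qed.

End Data.

Ltac pt_data := lazymatch goal with
  | |- polytime _ _ (fun n x => @in_mem (ordinal _) _ _) => apply: polytime_in_vars
  | |- polytime _ _ (fun n x => in_mem _ (@mem _ (seq_predType _) _)) => apply: polytime_in_lits
  | |- polytime _ _ (fun n x => in_mem _ _) =>
      first [ apply: polytime_in_clause | apply: polytime_in_vars ]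
  | |- polytime _ _ (fun n x => neg _) => apply: polytime_neg
  | |- polytime _ _ (fun n x => blocks _) => apply: polytime_blocks
  | |- polytime _ _ (fun n x => matrix _) => apply: polytime_matrix
  | |- polytime _ _ (fun n x => learn _ _) => apply: polytime_learn
  | |- polytime _ _ (fun n x => enum _) => apply: polytime_enum
  | |- _ => pt_base
  end.

Section PrefixQueries.
Variables (A : nat -> Type) (eA : encoder A).
Arguments eA : clear implicits.

Lemma polytime_existential F l : polytime eA eQcnf F -> polytime eA eLit l ->
  polytime eA eBool (fun n x => existential (F n x) (l n x)).
Proof. by move=> PF Pl; rewrite /existential; do !pt_data. Qed.

Lemma polytime_lv F l : polytime eA eQcnf F -> polytime eA eLit l ->
  polytime eA eNat (fun n x => lv (F n x) (l n x)).
Proof. by move=> PF Pl; rewrite /lv; do !pt_data. Qed.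

End PrefixQueries.

Ltac pt_prefix := lazymatch goal with
  | |- polytime _ _ (fun n x => existential _ _) => apply: polytime_existential
  | |- polytime _ _ (fun n x => lv _ _) => apply: polytime_lv
  | |- _ => pt_data
  end.

Section ClauseComprehension.
Variables (A : nat -> Type) (eA : encoder A).
Arguments eA : clear implicits.

Lemma polytime_reducible F (C : forall n, A n -> clause n) u :
  polytime eA eQcnf F -> polytime eA eClause C -> polytime eA eLit u ->
  polytime eA eBool (fun n x => reducible (F n x) (C n x) (u n x)).
Proof.
move=> PF PC Pu; apply: (@polytime_ext _ _ _ _ (fun n x => ~~ existential (F n x) (u n x) &&
    all (fun e => existential (F n x) e ==> (lv (F n x) e <= lv (F n x) (u n x))) (enum (C n x)))).
  move=> n x; rewrite /reducible; congr andb.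
  apply/forall_inP/allP => H e; first by rewrite mem_enum; apply: H.
  by rewrite -mem_enum; apply: H.
by do !pt_prefix.
Qed.

(** Clauses are coded through [enum], so the literals must be listed in exactly its order: by
    variable, the positive literal first. *)
Lemma polytime_all_lits : has_dim eA -> polytime eA (eSeq eLit) (fun n _ => enum {: lit n}).
Proof.
move=> Hn; apply: (@polytime_recode _ _ _ _ (eSeq (ePair eNat eBool)) _
  (fun n x => flatten [seq [:: (i, true); (i, false)] | i <- iota 0 n])); last first.
  by rewrite /has_dim in Hn; do !pt_prefix.
move=> n x; rewrite -val_enum_ord enumT unlock /= /prod_enum.
have -> : enum {: bool} = [:: true; false] by rewrite enumT unlock.
by rewrite /eSeq; elim: (enum 'I_n) => //= i s ->.
Qed.

Lemma polytime_setof (t : forall n, A n -> lit n -> bool) : has_dim eA ->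
  polytime (ePair eA eLit) eBool (fun n z => t n z.1 z.2) ->
  polytime eA eClause (fun n x => [set l | t n x l]).
Proof.
move=> Hn Pt; apply: (@polytime_recode _ _ _ _ (eSeq eLit) _
  (fun n x => filter (t n x) (enum {: lit n}))); last first.
  by apply: polytime_filter Pt; exact: polytime_all_lits.
move=> n x; rewrite /eClause; congr (eSeq _ _ _); rewrite enumT /enum_mem.
by apply: eq_filter => l; exact: in_set.
Qed.

Lemma polytime_set0 : polytime eA eClause (fun n _ => set0).
Proof. by apply: (@polytime_const _ _ _ _ Leaf) => n x; rewrite /eClause enum_set0. Qed.

End ClauseComprehension.

Section ClauseOperations.
Variables (A : nat -> Type) (eA : encoder A).
Arguments eA : clear implicits.

Lemma polytime_red F (C : forall n, A n -> clause n) :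
  polytime eA eQcnf F -> polytime eA eClause C ->
  polytime eA eClause (fun n x => red (F n x) (C n x)).
Proof.
move=> PF PC; have Hn : has_dim eA by exact: polytime_comp PF dim_qcnf.
apply: (@polytime_ext _ _ _ _
  (fun n x => [set l | (l \in C n x) && ~~ reducible (F n x) (C n x) l])) => //.
apply: polytime_setof Hn _; apply: polytime_andb; first by do !pt_prefix.
by apply: polytime_negb; apply: polytime_reducible; do !pt_prefix.
Qed.

Lemma polytime_resolvent (C D : forall n, A n -> clause n) l : has_dim eA ->
  polytime eA eClause C -> polytime eA eClause D -> polytime eA eLit l ->
  polytime eA eClause (fun n x => resolvent (C n x) (D n x) (l n x)).
Proof.
move=> Hn PC PD Pl; apply: (@polytime_ext _ _ _ _
  (fun n x => [set k | (k != l n x) && (k \in C n x) || (k != neg (l n x)) && (k \in D n x)])).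
  by move=> n x; apply/setP => k; rewrite !inE.
by apply: polytime_setof => //; do !pt_prefix.
Qed.

End ClauseOperations.

(** There are 2n literals, and each costs at most 2n + 10 in a list. *)
Definition clause_size n := 2 * n * (2 * n + 10) + 1.

Lemma tree_size_clause n (C : clause n) : tree_size (eClause n C) <= clause_size n.
Proof.
rewrite /eClause /eSeq tree_size_seq /clause_size addn1 ltnS.
apply: (@leq_trans (size (enum C) * (2 * n + 10))).
  apply: leq_sum_seq => l _; rewrite /eLit /ePair /eOrd /eBool /= tree_size_nat.
  by have := ltn_ord l.1; case: (l.2) => /=; lia.
rewrite leq_mul2r; apply/orP; right; rewrite -cardE.
by rewrite (leq_trans (max_card _)) // card_prod card_ord card_bool mulnC.
Qed.

Lemma dim_bound A (eA : encoder A) : has_dim eA -> poly_bounded eA (fun n _ => n).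
Proof.
move=> /polytime_output; apply: poly_le => n x; rewrite /eNat tree_size_nat; lia.
Qed.

Lemma clause_size_bound A (eA : encoder A) : has_dim eA ->
  poly_bounded eA (fun n _ => clause_size n).
Proof. by move=> /dim_bound Hn; rewrite /clause_size; poly_bound. Qed.

Section Entries.
Variables (A : nat -> Type) (eA : encoder A).
Arguments eA : clear implicits.

Definition propagated n (e : entry n) := if e is Propagate _ _ then true else false.

Definition antecedent n (e : entry n) := if e is Propagate _ D then D else set0.

(** An untyped tree, because what follows the tag is a literal or a pair depending on the tag. *)
Definition entry_rest n (e : entry n) : tree := if eEntry n e is Node _ t then t else Leaf.

Lemma polytime_decide l : polytime eA eLit l -> polytime eA eEntry (fun n x => Decide (l n x)).
Proof. by move=> Pl; exact: polytime_recode (polytime_pair (polytime_false eA) Pl). Qed.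

Lemma polytime_propagate l (C : forall n, A n -> clause n) :
  polytime eA eLit l -> polytime eA eClause C ->
  polytime eA eEntry (fun n x => Propagate (l n x) (C n x)).
Proof.
move=> Pl PC; exact: polytime_recode (polytime_pair (polytime_true eA) (polytime_pair Pl PC)).
Qed.

Lemma polytime_entry_parts (e : forall n, A n -> entry n) : polytime eA eEntry e ->
  polytime eA (ePair eBool eTree) (fun n x => (propagated (e n x), entry_rest (e n x))).
Proof. by apply: polytime_recode => n x; case: (e n x). Qed.

Lemma polytime_propagated e : polytime eA eEntry e ->
  polytime eA eBool (fun n x => propagated (e n x)).
Proof. by move=> /polytime_entry_parts/polytime_fst. Qed.

Lemma polytime_tree_head t : polytime eA eTree t ->
  polytime eA eTree (fun n x => if t n x is Node a _ then a else Leaf).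
Proof.
move=> Pt; apply: (polytime_comp (g := fun _ t => if t is Node a _ then a else Leaf) Pt).
exists Head, (fun n t => tree_size t) => [|n u]; first exact: (@poly_size _ eTree).
by exists (tree_size u) => //; exact: run_head.
Qed.

Lemma polytime_tree_tail t : polytime eA eTree t ->
  polytime eA eTree (fun n x => if t n x is Node _ b then b else Leaf).
Proof.
move=> Pt; apply: (polytime_comp (g := fun _ t => if t is Node _ b then b else Leaf) Pt).
exists Tail, (fun n t => tree_size t) => [|n u]; first exact: (@poly_size _ eTree).
by exists (tree_size u) => //; exact: run_tail.
Qed.

Lemma polytime_entry_lit e : polytime eA eEntry e ->
  polytime eA eLit (fun n x => entry_lit (e n x)).
Proof.
move=> Pe; have /polytime_snd Pr := polytime_entry_parts Pe.
have := polytime_if (polytime_propagated Pe) (polytime_tree_head Pr) Pr.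
by apply: polytime_recode => n x; case: (e n x).
Qed.

Lemma polytime_antecedent e : polytime eA eEntry e ->
  polytime eA eClause (fun n x => antecedent (e n x)).
Proof.
move=> Pe; have /polytime_snd Pr := polytime_entry_parts Pe.
have Pl : polytime eA eTree (fun _ _ => Leaf) by exact: (@polytime_const _ _ _ _ Leaf).
have := polytime_if (polytime_propagated Pe) (polytime_tree_tail Pr) Pl.
by apply: polytime_recode => n x; case: (e n x) => //= l; rewrite /eClause enum_set0.
Qed.

End Entries.

Ltac pt := lazymatch goal with
  | |- polytime _ _ (fun n x => reducible _ _ _) => apply: polytime_reducible
  | |- polytime _ _ (fun n x => set0) => exact: polytime_set0
  | |- polytime _ _ (fun n x => red _ _) => apply: polytime_red
  | |- polytime _ _ (fun n x => resolvent _ _ _) => apply: polytime_resolvent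
  | |- polytime _ _ (fun n x => Decide _) => apply: polytime_decide
  | |- polytime _ _ (fun n x => Propagate _ _) => apply: polytime_propagate
  | |- polytime _ _ (fun n x => propagated _) => apply: polytime_propagated
  | |- polytime _ _ (fun n x => entry_lit _) => apply: polytime_entry_lit
  | |- polytime _ _ (fun n x => antecedent _) => apply: polytime_antecedent
  | |- _ => pt_prefix
  end.

(** * Polynomial time translations *)

Definition entry_size n := clause_size n + 2 * n + 20.

Lemma tree_size_entry n (e : entry n) : tree_size (eEntry n e) <= entry_size n.
Proof.
have hl (l : lit n) : tree_size (tree_of_lit l) <= 2 * n + 10.
  rewrite /tree_of_lit /= tree_size_nat; have := ltn_ord l.1.
  by case: (l.2) => /=; lia.
rewrite /entry_size; case: e => [l|l C]; have := hl l.
  by rewrite (_ : tree_size (eEntry _ _) = (1 + tree_size (tree_of_lit l)).+1) //; lia.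
rewrite (_ : tree_size (eEntry _ _) =
             (3 + (tree_size (tree_of_lit l) + tree_size (tree_of_clause C)).+1).+1) //.
by have : tree_size (tree_of_clause C) <= _ := tree_size_clause C; lia.
Qed.

Lemma entry_size_bound A (eA : encoder A) : has_dim eA ->
  poly_bounded eA (fun n _ => entry_size n).
Proof.
by move=> Hn; have := clause_size_bound Hn; have := dim_bound Hn; rewrite /entry_size => *;
   poly_bound.
Qed.

Section ClauseTests.
Variables (A : nat -> Type) (eA : encoder A).
Arguments eA : clear implicits.

Lemma polytime_learn_step F (C : forall n, A n -> clause n) e :
  polytime eA eQcnf F -> polytime eA eClause C -> polytime eA eEntry e ->
  polytime eA eClause (fun n x => learn_step (F n x) (C n x) (e n x)).
Proof.
move=> PF PC Pe; have Hn : has_dim eA by exact: polytime_comp PF dim_qcnf.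
apply: (@polytime_ext _ _ _ _ (fun n x =>
  if propagated (e n x) && (neg (entry_lit (e n x)) \in C n x) then
    red (F n x) (resolvent (red (F n x) (antecedent (e n x))) (C n x) (entry_lit (e n x)))
  else C n x)).
  by move=> n x; case: (e n x).
by do !pt.
Qed.

Lemma polytime_falsified s (C : forall n, A n -> clause n) :
  polytime eA (eSeq eLit) s -> polytime eA eClause C ->
  polytime eA eBool (fun n x => falsified (s n x) (C n x)).
Proof.
move=> Ps PC; apply: polytime_ext (fun n x => falsifiedE _ _) _.
by do !pt.
Qed.

Lemma polytime_unit_under F s (C : forall n, A n -> clause n) p :
  polytime eA eQcnf F -> polytime eA (eSeq eLit) s -> polytime eA eClause C ->
  polytime eA eLit p ->
  polytime eA eBool (fun n x => unit_under (F n x) (s n x) (C n x) (p n x)).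
Proof.
move=> PF Ps PC Pp; apply: polytime_ext (fun n x => unit_underE _ _ _ _) _.
by do !pt.
Qed.

Lemma polytime_assignment es : polytime eA (eSeq eEntry) es ->
  polytime eA (eSeq eLit) (fun n x => assignment (es n x)).
Proof. by move=> Pes; rewrite /assignment; do !pt. Qed.

Lemma polytime_level_sort F s : polytime eA eQcnf F -> polytime eA (eSeq eLit) s ->
  polytime eA (eSeq eLit) (fun n x => level_sort (F n x) (s n x)).
Proof. by move=> PF Ps; rewrite /level_sort; do !pt. Qed.

End ClauseTests.

Section TrailScans.
Variables (A : nat -> Type) (eA : encoder A).
Arguments eA : clear implicits.

Lemma polytime_last_scheme F es (K : forall n, A n -> clause n) :
  polytime eA eQcnf F -> polytime eA (eSeq eEntry) es -> polytime eA eClause K ->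
  polytime eA eClause (fun n x => last_scheme (F n x) (Trail (es n x) (K n x))).
Proof.
move=> PF Pes PK; have Hn : has_dim eA by exact: polytime_comp PF dim_qcnf.
apply: polytime_ext (fun n x => last_learnable _ _) _ => /=.
apply: (@polytime_foldl_add _ _ _ _ _ _ _ _ (fun n x => learn_step (F n x))).
- by do !pt.
- by do !pt.
- by apply: polytime_learn_step; do !pt.
exists (fun n x => clause_size n); first exact: clause_size_bound.
by move=> n x C e _; apply: leq_trans (tree_size_clause _) (leq_addl _ _).
Qed.

Lemma polytime_conflicts F s : polytime eA eQcnf F -> polytime eA (eSeq eLit) s ->
  polytime eA (eSeq eClause) (fun n x => conflicts (F n x) (s n x)).
Proof.
move=> PF Ps; rewrite /conflicts; pt; first by do !pt.
by apply: polytime_falsified; do !pt.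
Qed.

Lemma polytime_propagations F s : polytime eA eQcnf F -> polytime eA (eSeq eLit) s ->
  polytime eA (eSeq eEntry) (fun n x => propagations (F n x) (s n x)).
Proof.
move=> PF Ps; rewrite /propagations; pt; pt; first by do !pt.
pt; last by do !pt.
pt; first by do !pt.
by apply: polytime_unit_under; do !pt.
Qed.

End TrailScans.

Definition eState := ePair (eSeq eLit) (eSeq eEntry).
Arguments eState : clear implicits.

Section TrailSteps.
Variables (A : nat -> Type) (eA : encoder A).
Arguments eA : clear implicits.

Lemma polytime_trail_step F st : polytime eA eQcnf F -> polytime eA eState st ->
  polytime eA eState (fun n x => trail_step (F n x) (st n x)).
Proof.
move=> PF Pst.
apply: (@polytime_ext _ _ _ _ (fun n x =>
  if conflicts (F n x) (assignment (st n x).2) is _ :: _ then st n x else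
  if propagations (F n x) (assignment (st n x).2) is e :: _ then
    ((st n x).1, rcons (st n x).2 e) else
  if (st n x).1 is d :: ds then
    if (d \in assignment (st n x).2) || (neg d \in assignment (st n x).2)
    then (ds, (st n x).2) else (ds, rcons (st n x).2 (Decide d))
  else st n x)).
  by move=> n x; case: (st n x).
have Pa : polytime eA (eSeq eLit) (fun n x => assignment (st n x).2).
  by apply: polytime_assignment; do !pt.
apply: polytime_seq_case; [exact: polytime_conflicts| |by do !pt].
apply: polytime_seq_case; [exact: polytime_propagations| |by do !pt].
apply: polytime_seq_case; [by do !pt|by do !pt|].
by do !first [apply: polytime_assignment | pt].
Qed.

End TrailSteps.

Lemma tree_size_rcons B (eB : encoder B) n (s : seq (B n)) b :
  tree_size (eSeq eB n (rcons s b)) = tree_size (eSeq eB n s) + (tree_size (eB n b)).+1.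
Proof. by rewrite /eSeq !tree_size_seq big_rcons /= addSn. Qed.

(** The second bound leaves out the pending decisions; it yields the size of the finished trail,
    which a round stores. *)
Lemma trail_step_growth n (F : qcnf n) st :
  tree_size (eState n (trail_step F st)) <= tree_size (eState n st) + (entry_size n).+1 /\
  tree_size (eSeq eEntry n (trail_step F st).2) <=
    tree_size (eSeq eEntry n st.2) + (entry_size n).+1.
Proof.
rewrite /eState /ePair; case: st => ds es /=.
case: (conflicts _ _) => [|_ _] /=; last by rewrite !leq_addr.
case: (propagations _ _) => [|e _] /=; last first.
  by rewrite tree_size_rcons; have := tree_size_entry e; lia.
case: ds => [|d ds] /=; first by rewrite !leq_addr.
have := tree_size_gt0 (tree_of_lit d); have := tree_size_entry (Decide d).
by case: ifP => _ /=; rewrite ?tree_size_rcons /eSeq /=; lia.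
Qed.

Lemma attempt_state_size n (F : qcnf n) ds :
  tree_size (eSeq eEntry n (attempt_state F ds).2) <=
    1 + (n + tree_size (eSeq eLit n ds)) * (entry_size n).+1.
Proof.
rewrite /attempt_state; apply: (@leq_trans (1 + (n + size ds) * (entry_size n).+1)).
  elim: (n + size ds) => // k IH; rewrite iterS mulSn.
  by have [_] := trail_step_growth F (iter k (trail_step F) (ds, [::])); lia.
rewrite leq_add2l leq_mul2r leq_add2l; apply/orP; right.
by rewrite /eSeq; elim: ds => //= d ds IH; lia.
Qed.

Section Scripts.
Variables (A : nat -> Type) (eA : encoder A).
Arguments eA : clear implicits.

Lemma polytime_attempt_state F ds : polytime eA eQcnf F -> polytime eA (eSeq eLit) ds ->
  polytime eA eState (fun n x => attempt_state (F n x) (ds n x)).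
Proof.
move=> PF Pds; have Hn : has_dim eA by exact: polytime_comp PF dim_qcnf.
apply: (polytime_iter (f := fun n x => trail_step (F n x))).
- by do !pt.
- by do !pt.
- by apply: polytime_trail_step; do !pt.
exists (fun n x => (entry_size n).+1).
  by have := entry_size_bound Hn => H; poly_bound.
by move=> n x st; have [] := trail_step_growth (F n x) st.
Qed.

Lemma polytime_round es (K C : forall n, A n -> clause n) :
  polytime eA (eSeq eEntry) es -> polytime eA eClause K -> polytime eA eClause C ->
  polytime eA eRound (fun n x => Round (Trail (es n x) (K n x)) (C n x) 0).
Proof.
move=> Pes PK PC.
exact: polytime_recode (polytime_pair (polytime_pair Pes PK)
                                      (polytime_pair PC (polytime_zero eA))).
Qed.

Lemma polytime_round_trail (R : forall n, A n -> round n) : polytime eA eRound R ->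
  polytime eA (ePair (eSeq eEntry) eClause)
    (fun n x => (entries (round_trail (R n x)), conflict (round_trail (R n x)))).
Proof.
move=> PR; have : polytime eA (ePair (ePair (eSeq eEntry) eClause) (ePair eClause eNat))
   (fun n x => ((entries (round_trail (R n x)), conflict (round_trail (R n x))),
                (learned (R n x), backtrack (R n x)))) by exact: polytime_recode PR.
exact: polytime_fst.
Qed.

Lemma polytime_repeat_tasks ts : has_dim eA -> polytime eA (eSeq (eSeq eLit)) ts ->
  polytime eA (eSeq (eSeq eLit)) (fun n x => repeat_tasks (ts n x)).
Proof. by move=> Hn Pts; rewrite /repeat_tasks; do !pt. Qed.

Lemma polytime_literal_tasks F (C : forall n, A n -> clause n) :
  polytime eA eQcnf F -> polytime eA eClause C ->
  polytime eA (eSeq (eSeq eLit)) (fun n x => literal_tasks (F n x) (C n x)).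
Proof.
move=> PF PC; rewrite /literal_tasks /negs_but.
by do !first [apply: polytime_level_sort | pt].
Qed.

Lemma polytime_reduction_tasks F (C : forall n, A n -> clause n) :
  polytime eA eQcnf F -> polytime eA eClause C ->
  polytime eA (eSeq (eSeq eLit)) (fun n x => reduction_tasks (F n x) (C n x)).
Proof.
move=> PF PC; have Hn : has_dim eA by exact: polytime_comp PF dim_qcnf.
by rewrite /reduction_tasks /negs; do !first [apply: polytime_level_sort | pt].
Qed.

End Scripts.

Lemma polytime_script :
  polytime (ePair eQcnf (eSeq eClause)) (eSeq (eSeq eLit)) (fun n x => script x.1 x.2).
Proof.
rewrite /script /clause_script.
do !first [ apply: polytime_repeat_tasks | apply: polytime_literal_tasks
          | apply: polytime_reduction_tasks | pt ].
Qed.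

Definition eSim := ePair eQcnf (eSeq eRound).
Arguments eSim : clear implicits.

Lemma sim_stepE n (st : qcnf n * seq (round n)) ds : sim_step last_scheme st ds =
  if conflicts st.1 (assignment (attempt_state st.1 ds).2) is C :: _ then
    (learn st.1 (last_scheme st.1 (Trail (attempt_state st.1 ds).2 C)),
     rcons st.2 (Round (Trail (attempt_state st.1 ds).2 C)
                   (last_scheme st.1 (Trail (attempt_state st.1 ds).2 C)) 0))
  else st.
Proof. by rewrite /sim_step /attempt; case: (conflicts _ _). Qed.

(** A round stores its conflict clause, its trail and the learned clause, and the formula receives
    the learned clause again: three clauses and one trail. *)
Lemma sim_step_growth n (st : qcnf n * seq (round n)) ds :
  tree_size (eSim n (sim_step last_scheme st ds)) <= tree_size (eSim n st) +
    (3 * clause_size n + (n + tree_size (eSeq eLit n ds)) * (entry_size n).+1 + 10).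
Proof.
rewrite sim_stepE; have := attempt_state_size st.1 ds.
case: (conflicts _ _) => [|K _] hes; first by rewrite leq_addr.
have nodeE a b : tree_size (Node a b) = (tree_size a + tree_size b).+1 by [].
rewrite /eSim /ePair !nodeE [(_, _).1]/= [(_, _).2]/= tree_size_rcons.
set C := last_scheme _ _; set es := (attempt_state _ _).2 in hes *.
rewrite [blocks (learn _ _)]/=.
have -> : tree_size (tree_of_seq (@tree_of_clause n) (matrix (learn st.1 C))) =
    tree_size (tree_of_seq (@tree_of_clause n) (matrix st.1)) + (tree_size (eClause n C)).+1.
  exact: (@tree_size_rcons _ eClause).
have -> : tree_size (eRound n (Round (Trail es K) C 0)) =
    (tree_size (eSeq eEntry n es) + tree_size (eClause n K)).+1 + (tree_size (eClause n C) + 1).+1 + 1.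
  by rewrite addn1.
by have := tree_size_clause K; have := tree_size_clause C; rewrite /=; lia.
Qed.

Lemma polytime_sim_step A (eA : encoder A) st ds :
  polytime eA eSim st -> polytime eA (eSeq eLit) ds ->
  polytime eA eSim (fun n x => sim_step last_scheme (st n x) (ds n x)).
Proof.
move=> Pst Pds; apply: polytime_ext (fun n x => sim_stepE _ _) _.
have P1 : polytime eA eQcnf (fun n x => (st n x).1) by do !pt.
have P2 : polytime eA (eSeq eRound) (fun n x => (st n x).2) by do !pt.
have Pes : polytime eA (eSeq eEntry) (fun n x => (attempt_state (st n x).1 (ds n x)).2).
  by apply: polytime_snd; exact: polytime_attempt_state.
apply: polytime_seq_case => //.
  by apply: polytime_conflicts => //; exact: polytime_assignment.
by do !first [ apply: polytime_last_scheme | apply: polytime_round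
             | apply: polytime_attempt_state | pt ].
Qed.

Definition translate n (x : qcnf n * seq (clause n)) : seq (round n) :=
  (simulate last_scheme (x.1, [::]) (script x.1 x.2)).2.

Lemma polytime_translate : polytime (ePair eQcnf (eSeq eClause)) (eSeq eRound) translate.
Proof.
have Hn : has_dim (ePair eQcnf (eSeq eClause)) by pt_dim.
suff : polytime (ePair eQcnf (eSeq eClause)) eSim
    (fun n x => foldl (@sim_step last_scheme n) (x.1, [::]) (script x.1 x.2)).
  exact: polytime_snd.
apply: (@polytime_foldl_add _ _ _ _ _ _ _ _ (fun n x => @sim_step last_scheme n) polytime_script).
- by do !pt.
- by apply: polytime_sim_step; do !pt.
exists (fun n x => 3 * clause_size n +
    (n + tree_size (eSeq (eSeq eLit) n (script x.1 x.2))) * (entry_size n).+1 + 10).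
  have := clause_size_bound Hn; have := entry_size_bound Hn; have := dim_bound Hn.
  by have := polytime_output polytime_script => *; poly_bound.
move=> n x st ds hds; apply: leq_trans (sim_step_growth st ds) _.
by rewrite leq_add2l leq_add2r leq_add2l leq_mul2r leq_add2l hds orbT.
Qed.

Lemma polytime_trail_lines A (eA : encoder A) F es (K : forall n, A n -> clause n) :
  polytime eA eQcnf F -> polytime eA (eSeq eEntry) es -> polytime eA eClause K ->
  polytime eA (eSeq eClause) (fun n x => trail_lines (F n x) (es n x) (K n x)).
Proof.
move=> PF Pes PK; have Hn : has_dim eA by exact: polytime_comp PF dim_qcnf.
suff : polytime eA (ePair eClause (eSeq eClause)) (fun n x =>
    foldl (line_step (F n x)) (red (F n x) (K n x), [:: K n x; red (F n x) (K n x)])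
          (rev (es n x))) by exact: polytime_snd.
apply: (@polytime_foldl_add _ _ _ _ _ _ _ _ (fun n x => line_step (F n x))).
- by do !pt.
- by do !pt.
- apply: (@polytime_ext _ _ _ _ (fun n z =>
    let R := resolvent (red (F n z.1.1) (antecedent z.2)) z.1.2.1 (entry_lit z.2) in
    if propagated z.2 && (neg (entry_lit z.2) \in z.1.2.1) then
      (red (F n z.1.1) R, z.1.2.2 ++ [:: antecedent z.2; red (F n z.1.1) (antecedent z.2);
                                        R; red (F n z.1.1) R])
    else z.1.2)) => [n [[x st] [d|p D]] //|] /=.
  by do !pt.
exists (fun n x => 5 * clause_size n + 10).
  by have := clause_size_bound Hn => H; poly_bound.
move=> n x [C ls] [d|p D] _ /=; first by rewrite leq_addr.
case: ifP => _; last by rewrite leq_addr.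
set R := resolvent _ _ _; rewrite /ePair /=.
have -> : tree_size (eSeq eClause n (ls ++ [:: D; red (F n x) D; R; red (F n x) R])) =
    tree_size (eSeq eClause n ls) + ((tree_size (eClause n D)).+1 +
      (tree_size (eClause n (red (F n x) D))).+1 + (tree_size (eClause n R)).+1 +
      (tree_size (eClause n (red (F n x) R))).+1).
  by rewrite -!cat_rcons cats0 !tree_size_rcons -!addnA.
have := tree_size_clause D; have := tree_size_clause R.
by have := tree_size_clause (red (F n x) D); have := tree_size_clause (red (F n x) R); lia.
Qed.

Lemma polytime_qres_lines A (eA : encoder A) F iota :
  polytime eA eQcnf F -> polytime eA (eSeq eRound) iota ->
  polytime eA (eSeq eClause) (fun n x => qres_lines (F n x) (iota n x)).
Proof.
move=> PF Pi; rewrite /qres_lines /round_lines; pt; last by do !pt.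
pt; pt; first by do !pt.
have PR : polytime (ePair eA eRound) (ePair (eSeq eEntry) eClause)
    (fun n z => (entries (round_trail z.2), conflict (round_trail z.2))).
  by apply: polytime_round_trail; do !pt.
apply: polytime_trail_lines; first by do !pt.
  exact: (polytime_fst PR).
exact: (polytime_snd PR).
Qed.

Lemma p_simulatesI S S' (f : forall n, qcnf n * proof S' n -> proof S n) :
  polytime (ePair eQcnf (@tree_of_proof S')) (@tree_of_proof S) f ->
  (forall n (F : qcnf n) (pi : proof S' n), wf_qcnf F -> refutes F pi ->
     refutes F (f n (F, pi))) ->
  p_simulates S S'.
Proof.
move=> [p [h [k Hk] rp]] fP; exists p, k => n F pi wf ref.
have [t rt th] := rp n (F, pi); exists (f n (F, pi)), t.
by split; [exact: fP|exact: rt|exact: leq_trans th (Hk _ _)].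
Qed.

Lemma ass_simulates_qres : p_simulates (QCDCL_NO_RED ASS_ORD) Qres.
Proof.
apply: (@p_simulatesI (QCDCL_NO_RED ASS_ORD) Qres translate polytime_translate) => n F pi wf ref.
by have [] := simulate_refutation last_scheme_asserting wf ref.
Qed.

Lemma any_simulates_qres : p_simulates (QCDCL_NO_RED ANY_ORD) Qres.
Proof.
apply: (@p_simulatesI (QCDCL_NO_RED ANY_ORD) Qres translate polytime_translate) => n F pi wf ref.
by apply: qcdcl_ass_any; have [] := simulate_refutation last_scheme_asserting wf ref.
Qed.

Lemma polytime_qres_lines_pair : polytime (ePair eQcnf (eSeq eRound)) (eSeq eClause)
  (fun n x => qres_lines x.1 x.2).
Proof. by apply: polytime_qres_lines; do !pt. Qed.

Lemma qres_simulates_qcdcl P : p_simulates Qres (QCDCL_NO_RED P).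
Proof.
apply: (@p_simulatesI Qres (QCDCL_NO_RED P) _ polytime_qres_lines_pair) => n F iota _.
exact: qres_lines_refutation.
Qed.

Lemma any_simulates_ass : p_simulates (QCDCL_NO_RED ANY_ORD) (QCDCL_NO_RED ASS_ORD).
Proof.
have Pid : polytime (ePair eQcnf (eSeq eRound)) (eSeq eRound) (fun n x => x.2) by do !pt.
apply: (@p_simulatesI (QCDCL_NO_RED ANY_ORD) (QCDCL_NO_RED ASS_ORD) _ Pid) => n F iota _.
exact: qcdcl_ass_any.
Qed.

(** Trails with arbitrary decisions cannot be reordered by level directly, so the refutation is read
    off as Q-resolution and simulated afresh. *)
Lemma ass_simulates_any : p_simulates (QCDCL_NO_RED ASS_ORD) (QCDCL_NO_RED ANY_ORD).
Proof.
have Pt : polytime (ePair eQcnf (eSeq eRound)) (eSeq eRound)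
    (fun n x => translate (x.1, qres_lines x.1 x.2)).
  apply: (polytime_comp _ polytime_translate); apply: polytime_pair; first by do !pt.
  exact: polytime_qres_lines_pair.
apply: (@p_simulatesI (QCDCL_NO_RED ASS_ORD) (QCDCL_NO_RED ANY_ORD) _ Pt) => n F iota wf ref.
by have [] := simulate_refutation last_scheme_asserting wf (qres_lines_refutation ref).
Qed.

Theorem theorem6p9 :
  [/\ p_simulates (QCDCL_NO_RED ASS_ORD) Qres,
      exists c : nat, forall xi : scheme, asserting_scheme ASS_ORD xi ->
        forall (n : nat) (F : qcnf n) (pi : seq (clause n)),
          wf_qcnf F -> qres_refutation F pi ->
          exists iota : seq (round n),
            [/\ qcdcl_refutation ASS_ORD F iota,
                uses_scheme xi F iota
              & 0 < n -> qcdcl_size iota <= c * (n ^ 3 * size pi)],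
      p_equivalent Qres (QCDCL_NO_RED ANY_ORD),
      p_equivalent Qres (QCDCL_NO_RED ASS_ORD)
    & p_equivalent (QCDCL_NO_RED ANY_ORD) (QCDCL_NO_RED ASS_ORD)].
Proof.
split.
- exact: ass_simulates_qres.
- exists 10 => xi xiP n F pi wf ref.
  by exists (simulate xi (F, [::]) (script F pi)).2; exact: simulate_refutation.
- by split; [exact: qres_simulates_qcdcl|exact: any_simulates_qres].
- by split; [exact: qres_simulates_qcdcl|exact: ass_simulates_qres].
- by split; [exact: any_simulates_ass|exact: ass_simulates_any].
Qed.
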